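(* For all constants $c>0$ and $d>1$ there exists $\kappa_0=\kappa_0(c,d)>0$ such that the following holds for every $\rho\in\mathbb{R}\setminus\mathbb{Q}$ satisfying the Diophantine condition $\mathrm{dist}(n\rho,\mathbb{Z})\geq c\,n^{-d}$ for all integers $n\geq 1$, and for every $\kappa\geq\kappa_0$. Let $\Phi^+\subseteq\mathbb{T}^1\times[0,1]$ be the upper bounding graph of the map $F_\kappa(\theta,x)=(\theta+\rho \bmod 1,\ \tanh(\kappa x)\cdot\sin(\pi\theta))$ on $\mathbb{T}^1\times[0,1]$. Then the Hausdorff dimension of $\Phi^+$ is $D_H(\Phi^+)=1$. Furthermore, the one-dimensional Hausdorff measure of $\Phi^+$ is infinite.
   Context: $\mathbb{T}^1=\mathbb{R}/\mathbb{Z}$ with its usual metric, and in $\sin(\pi\theta)$ the point $\theta\in\mathbb{T}^1$ is represented in $[0,1)$. The space $\mathbb{T}^1\times[0,1]$ carries the usual product metric. The global attractor is $\mathcal{A}=\bigcap_{n\in\mathbb{N}}F_\kappa^n(\mathbb{T}^1\times[0,1])$. The upper bounding graph is the function $\varphi^+:\mathbb{T}^1\to[0,1]$, $\varphi^+(\theta)=\sup\{x\in[0,1]\mid(\theta,x)\in\mathcal{A}\}$, and its point set is $\Phi^+=\{(\theta,\varphi^+(\theta))\mid\theta\in\mathbb{T}^1\}$. For a subset $A$ of a separable metric space, $\mathcal{H}^s(A)=\lim_{\varepsilon\to0}\inf\{\sum_i(\mathrm{diam}\,A_i)^s \mid \{A_i\}\text{ a finite or countable cover of }A,\ \mathrm{diam}\,A_i\leq\varepsilon\}$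 is the $s$-dimensional Hausdorff measure and $D_H(A)=\sup\{s\geq0\mid\mathcal{H}^s(A)=\infty\}$ is the Hausdorff dimension. *)

(* Defs.v *)
From HB Require Import structures.
From mathcomp Require Import all_boot all_order all_algebra.
From mathcomp Require Import all_classical all_reals all_analysis.
From mathcomp Require Import lra.

Set Implicit Arguments.
Unset Strict Implicit.
Unset Printing Implicit Defensive.

Import Order.TTheory GRing.Theory Num.Theory.
Import numFieldNormedType.Exports.

Local Open Scope classical_set_scope.
Local Open Scope ring_scope.

Section dist_int.
Context {R : realType}.
Implicit Types x y : R.

Definition dist_int x : R := inf (range (fun k : int => `|x - k%:~R|)).

Lemma dist_int_le x (k : int) : dist_int x <= `|x - k%:~R|.
Proof. by apply: ge_inf; [exists 0 => _ [l _ <-] | exists k]. Qed.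

Lemma dist_int_ge x a : (forall k : int, a <= `|x - k%:~R|) -> a <= dist_int x.
Proof.
move=> h; apply: lb_le_inf; first by exists `|x - 0%:~R|; exists 0.
by move=> _ [k _ <-].
Qed.

Lemma dist_int0 : dist_int 0 = 0 :> R.
Proof.
apply/eqP; rewrite eq_le; apply/andP; split; last exact: dist_int_ge.
by have := dist_int_le 0 0; rewrite subr0 normr0.
Qed.

Lemma dist_intN x : dist_int (- x) = dist_int x.
Proof.
suff h y : dist_int (- y) <= dist_int y.
  by apply/eqP; rewrite eq_le h -{1}(opprK x) h.
apply: dist_int_ge => k; apply: le_trans (dist_int_le (- y) (- k)) _.
by rewrite rmorphN -opprD normrN.
Qed.

Lemma dist_intD x y : dist_int (x + y) <= dist_int x + dist_int y.
Proof.
rewrite -lerBlDr; apply: dist_int_ge => k.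
rewrite lerBlDl -lerBlDr; apply: dist_int_ge => l.
rewrite lerBlDl; apply: le_trans (dist_int_le (x + y) (k + l)) _.
by rewrite rmorphD opprD addrACA ler_normD.
Qed.

Lemma dist_int_eq0 x : `|x| < 1 -> dist_int x = 0 -> x = 0.
Proof.
move=> x1 d0; apply/eqP/negPn/negP => x_neq0.
have xgt0 : 0 < `|x| by rewrite normr_gt0.
suff : Num.min `|x| (1 - `|x|) <= dist_int x.
  by rewrite d0 leNgt lt_min xgt0 subr_gt0 x1.
apply: dist_int_ge => k; rewrite ge_min.
have [->|k0] := eqVneq k 0; first by rewrite subr0 lexx.
apply/orP; right; rewrite lerBlDl.
have k1 : 1 <= `|k%:~R : R|.
  by rewrite -intr_norm -[1]/(1%:~R) ler_int -gtz0_ge1 normr_gt0.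
apply: le_trans k1 _.
by rewrite -[X in `|X| <= _](subKr x) (le_trans (ler_normB _ _)).
Qed.

End dist_int.

(* The circle R/Z, each point being given by its representative in [0, 1). *)
Record circle (R : realType) := Circle {
  circle_repr : R;
  circle_reprP : 0 <= circle_repr < 1
}.

HB.instance Definition _ (R : realType) := [isSub for @circle_repr R].
HB.instance Definition _ (R : realType) := [Choice of circle R by <:].

Section circle_metric.
Context {R : realType}.
Implicit Types t u v : circle R.

Definition circle_dist t u : R := dist_int (circle_repr t - circle_repr u).

Lemma circle_distxx t : circle_dist t t = 0.
Proof. by rewrite /circle_dist subrr dist_int0. Qed.

Lemma circle_dist_eq0 t u : circle_dist t u = 0 -> t = u.
Proof.
move=> /dist_int_eq0 tu; apply: val_inj; apply/eqP; rewrite -subr_eq0.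
apply/eqP/tu; have := circle_reprP t; have := circle_reprP u.
by rewrite ltr_norml; lra.
Qed.

Lemma circle_distC t u : circle_dist t u = circle_dist u t.
Proof. by rewrite /circle_dist -dist_intN opprB. Qed.

Lemma circle_dist_triangle u t v :
  circle_dist t v <= circle_dist t u + circle_dist u v.
Proof. by rewrite /circle_dist -(subrKA (circle_repr u) (circle_repr t)) dist_intD. Qed.

End circle_metric.

HB.instance Definition _ (R : realType) := @isMetric.Build R (circle R)
  circle_dist circle_distxx circle_dist_eq0 circle_distC circle_dist_triangle.

Section circle_of.
Context {R : realType}.

Lemma mod1_itv (x : R) : 0 <= x - (Num.floor x)%:~R < 1.
Proof. by rewrite subr_ge0 ltrBlDl -intrD1 floor_le_tmp floorD1_gt. Qed.

Definition circle_of (x : R) : circle R := Circle (mod1_itv x).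

End circle_of.

Section hausdorff.
Context {R : realType} {T : pseudoMetricType R}.
Implicit Types A : set T.
Local Open Scope ereal_scope.

(* The maximum with 0 only matters for the empty set. *)
Definition diam A : \bar R := maxe 0 (ereal_sup (edist @` (A `*` A))).

(* Finite and countable covers alike are indexed by a set D of naturals. For
   s = 0 the convention is 0 `^ 0 = 1. *)
Definition hausdorff_premeasure (s e : R) A : \bar R :=
  ereal_inf [set h | exists (D : set nat) (C : nat -> set T),
    [/\ A `<=` \bigcup_(i in D) C i,
        forall i, D i -> diam (C i) <= e%:E
      & h = \esum_(i in D) (diam (C i) `^ s)]].

Definition hausdorff_measure (s : R) A : \bar R :=
  lim (hausdorff_premeasure s e A @[e --> 0^'+]).

(* The maximum with 0 is the convention that the supremum, taken in [0, +oo],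
   of the empty set is 0. *)
Definition hausdorff_dimension A : \bar R :=
  maxe 0 (ereal_sup
    [set s%:E | s in [set s : R | (0 <= s)%R /\ hausdorff_measure s A = +oo]]).

End hausdorff.

(* The phase space is a subset of circle R * R; the metric of that product is
   the library's, the maximum of the two coordinate distances. *)
Section pinched_system.
Context {R : realType}.

Definition tanh (x : R) : R :=
  (expR x - expR (- x)) / (expR x + expR (- x)).

Definition pinched_map (kappa rho : R) (p : circle R * R) : circle R * R :=
  (circle_of (circle_repr p.1 + rho), tanh (kappa * p.2) * sin (pi * circle_repr p.1)).

Definition phase_space : set (circle R * R) := setT `*` `[0, 1].

Definition global_attractor (kappa rho : R) : set (circle R * R) :=
  \bigcap_(n : nat) (iter n (pinched_map kappa rho) @` phase_space).

Definition upper_bounding_graph (kappa rho : R) (t : circle R) : R :=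
  sup [set x | `[0, 1]%classic x /\ global_attractor kappa rho (t, x)].

Definition upper_graph_set (kappa rho : R) : set (circle R * R) :=
  range (fun t => (t, upper_bounding_graph kappa rho t)).

(* dist_int plays the role of dist(., Z); `^ is the real power. *)
Definition diophantine (c d rho : R) : Prop :=
  forall n : nat, (1 <= n)%N -> c * n%:R `^ (- d) <= dist_int (n%:R * rho).

End pinched_system.

(* Main.v *)
Require Import Defs.
From mathcomp Require Import all_boot all_order all_algebra.
From mathcomp Require Import all_classical all_reals all_analysis.
From mathcomp Require Import lra ring zify.
Import Order.TTheory GRing.Theory Num.Theory.
Import numFieldNormedType.Exports.
Local Open Scope classical_set_scope.
Local Open Scope ring_scope.

Set Implicit Arguments.
Unset Strict Implicit.
Unset Printing Implicit Defensive.

(** Write [s(x) = |sin (pi x)|] for the forcing and [phi] for the upper bounding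
    graph. The latter is the decreasing limit of the images [phi_n] of the
    constant line [1] ([upper_bounding_graphE]).

    Fibrewise contraction. The forcing cancels in ratios of heights over the
    same point, and [tanh] never expands logarithmic distances; it contracts
    them strongly at heights [z] with [kappa z] above a threshold
    ([ln_step_contract]). Below the threshold the fibre map multiplies heights
    by the forcing times a factor that is large with [kappa]. As heights never
    exceed [1], an orbit can be low only for a small proportion of the time,
    provided that the products of the forcing along it decay at most at a fixed
    exponential rate ([orbit_growth], [pow_low_count]). Points whose backward
    orbits have this property are called tame. The Diophantine condition
    separates the points of an orbit, and a divide and conquer argument
    ([window_prod_lower]) shows that the product of the forcing over [N]
    consecutive times is at least exponential in [N] times its smallest factor.
    Hence every point that avoids, for all [i >= 1], the strip
    [s(x - i rho) < e 2^-i] is tame ([tame_of_pinch_ge]). On tame points with a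
    given constant, [phi] is bounded away from zero and Lipschitz
    ([upper_limit_lipschitz]): the contraction beats the growth, at an
    exponential rate, of the derivative of the logarithm of the forcing.

    Dimension at most one. The graph is a countable union of Lipschitz graphs
    and of a set lying over a limsup of exponentially small arcs around the
    orbit of the pinched point. Both are null for the [s]-dimensional measure
    when [s > 1] ([lipschitz_graph_covered], [limsup_strips_covered]).

    Infinite length. The pinched point [0] is itself tame, and the restriction
    of [phi] to the points avoiding the strips extends to a Lipschitz curve
    around it. Push this curve over [[0, tau]], with [tau] of order [N^-D],
    forward by [n] iterates, [0 < n < N]. All images vanish at their left end point, and
    about half of them reach a fixed height at the right one. They run in the
    graph except over the strips, of which only those of index at least [A N]
    meet [[0, tau]]; these are so thin that their images have negligible total
    length, although [N] iterates expand exponentially. So each of about [N / 2]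
    pieces of the graph projects vertically onto a set of length bounded below
    ([piece_length]). The pieces are separated by the Diophantine condition, so
    their contributions to a fine cover add up ([premeasure_unbounded]), and [N]
    is arbitrary. *)

(** * Elementary estimates *)

Section elementary_estimates.
Context {R : realType}.

(** Unfolding of the recursion [d (i + 1) <= h i * d i + f i]. *)
Lemma affine_recursion_le n (d h f : nat -> R) : d 0%N = 0 ->
  (forall i, 0 <= h i) ->
  (forall i, (i < n)%N -> d i.+1 <= h i * d i + f i) ->
  d n <= \sum_(0 <= j < n) (\prod_(j.+1 <= i < n) h i) * f j.
Proof.
move=> d0 h0; elim: n => [|n IH] hd; first by rewrite big_geq// d0.
apply: le_trans (hd n (ltnSn n)) _.
rewrite big_nat_recr//= [X in _ + X * f n]big_geq// mul1r lerD2r.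
have {}IH := IH (fun i ni => hd i (ltnW ni)).
apply: le_trans (ler_wpM2l (h0 n) IH) _.
rewrite mulr_sumr le_eqVlt; apply/orP; left; apply/eqP.
apply: eq_big_nat => j /andP[_ jn].
by rewrite big_nat_recr//= mulrA (mulrC (h n)).
Qed.

Lemma geometric_sum_le (q : R) n : 0 <= q < 1 ->
  \sum_(i < n) q ^+ i <= (1 - q)^-1.
Proof.
move=> /andP[q0 q1].
rewrite -[leRHS]mul1r ler_pdivlMr ?subr_gt0// mulrC.
have S := subrXX (1 : R) q n.
have E : \sum_(i < n) (1 : R) ^+ (n.-1 - i) * q ^+ i = \sum_(i < n) q ^+ i.
  by apply: eq_bigr => i _; rewrite expr1n mul1r.
have qn : 0 <= q ^+ n by rewrite exprn_ge0.
by rewrite -E -S expr1n; lra.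
Qed.

Lemma sum_half_le n : \sum_(0 <= j < n) (1 / 2 : R) ^+ (n - j.+1) <= 2.
Proof.
rewrite big_nat_rev/= big_mkord.
rewrite (eq_bigr (fun i : 'I_n => (1 / 2 : R) ^+ i)); last first.
  by move=> i _; congr (_ ^+ _); have := ltn_ord i; lia.
have q01 : 0 <= (1 / 2 : R) < 1 by apply/andP; split; lra.
have := geometric_sum_le n q01.
have -> : (1 - 1 / 2)^-1 = 2 :> R by field.
exact.
Qed.

Lemma expr_small (q e : R) : 0 <= q < 1 -> 0 < e -> exists n, q ^+ n < e.
Proof.
move=> /andP[q0 q1] e0.
have /cvgr0Pnorm_lt /(_ e e0) [n _ /(_ n (leqnn n))] : (fun n => q ^+ n) @ \oo --> 0.
  by apply: cvg_expr; rewrite ger0_norm.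
move=> h; exists n; exact: le_lt_trans (ler_norm _) h.
Qed.

Lemma poly_le_expn_bound D : exists2 B : R, 0 < B &
  forall i, (0 < i)%N -> i%:R ^+ D <= B * 2 ^+ i.
Proof.
have l2 : 0 < ln 2 :> R by rewrite ln_gt0//; lra.
have f0 : 0 < D.+1`!%:R :> R by rewrite ltr0n fact_gt0.
exists (D.+1`!%:R / ln 2 ^+ D.+1); first by rewrite divr_gt0// exprn_gt0.
move=> i i0; have i1 : 1 <= i%:R :> R by rewrite ler1n.
apply: (@le_trans _ _ (i%:R ^+ D.+1)); first by rewrite exprS ler_peMl// exprn_ge0.
have il : 0 <= i%:R * ln 2 :> R by rewrite mulr_ge0// ltW.
have := expR_ge1Dxn D il; rewrite expRM_natl lnK ?posrE// => h.
have {}h : (i%:R * ln 2) ^+ D.+1 / D.+1`!%:R <= 2 ^+ i :> R by lra.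
by rewrite mulrAC ler_pdivlMr ?exprn_gt0// -exprMn [leRHS]mulrC -ler_pdivrMr.
Qed.

Lemma poly_le_expn (C : R) D : exists N0, forall N, (N0 <= N)%N ->
  C * N%:R ^+ D <= 2 ^+ N.
Proof.
have [B B0 hB] := poly_le_expn_bound D.+1.
exists (Num.truncn `|C * B|).+1 => N NN.
have N0 : (0 < N)%N by exact: leq_trans NN.
have Np : 0 < N%:R :> R by rewrite ltr0n.
have CB : C * B <= N%:R.
  rewrite (le_trans (ler_norm _))// (le_trans (ltW (truncnS_gt _)))//.
  by rewrite ler_nat.
have := hB N N0; rewrite exprS => h.
have [C0|C0] := leP C 0.
  by rewrite (@le_trans _ _ 0) ?mulr_le0_ge0 ?exprn_ge0.
have t0 : 0 < 2 ^+ N :> R by rewrite exprn_gt0.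
rewrite -(ler_pM2l Np) mulrCA.
apply: le_trans (ler_wpM2l (ltW C0) h) _.
by rewrite mulrA ler_pM2r.
Qed.

(** [k] counts the indices below [N] that are neither [0] nor among the [l]
    exceptional ones. *)
Lemma half_count N m k l : (2 * l <= N)%N -> (N <= k + l + 1)%N ->
  (2 * m + 4 <= N)%N -> (m <= k)%N.
Proof. lia. Qed.

(** McShane's extension, truncated so as to keep the bounds of [f]. *)
Lemma lipschitz_extension (K : set R) (f : R -> R) (L a b : R) : 0 <= L ->
  K !=set0 -> (forall x, K x -> a <= f x <= b) ->
  (forall x y, K x -> K y -> `|f x - f y| <= L * `|x - y|) ->
  exists g : R -> R, [/\ forall x, K x -> g x = f x,
    forall x y, `|g x - g y| <= L * `|x - y| & forall x, a <= g x <= b].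
Proof.
move=> L0 [k0 Kk0] fab fL.
pose E x := [set f k + L * `|x - k| | k in K].
have Elb x : lbound (E x) a.
  move=> _ [k Kk <-]; have /andP[fa _] := fab k Kk.
  by rewrite ler_wpDr// mulr_ge0.
have E0 x : E x !=set0 by exists (f k0 + L * `|x - k0|), k0.
pose g1 x := inf (E x).
have g1_le x k : K k -> g1 x <= f k + L * `|x - k|.
  by move=> Kk; apply: ge_inf; [exists a; exact: Elb | exists k].
have g1_ge x v : (forall k, K k -> v <= f k + L * `|x - k|) -> v <= g1 x.
  by move=> h; apply: lb_le_inf => // _ [k Kk <-]; exact: h.
have g1a x : a <= g1 x by apply: lb_le_inf.
have g1f x : K x -> g1 x = f x.
  move=> Kx; apply/eqP; rewrite eq_le; apply/andP; split.
    by have := g1_le x x Kx; rewrite subrr normr0 mulr0 addr0.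
  apply: g1_ge => k Kk; have := fL x k Kx Kk; rewrite ler_norml => /andP[_].
  lra.
have g1L x y : g1 x <= g1 y + L * `|x - y|.
  rewrite -lerBlDr; apply: g1_ge => k Kk; rewrite lerBlDr.
  apply: le_trans (g1_le x k Kk) _; rewrite -addrA lerD2l -mulrDr ler_wpM2l//.
  by rewrite [leRHS]addrC -[x - k](subrKA y) ler_normD.
exists (fun x => Num.min b (g1 x)); split.
- move=> x Kx; rewrite g1f//; apply/min_idPr.
  by case/andP: (fab x Kx).
- move=> x y; have h1 := g1L x y; have := g1L y x; rewrite (distrC y x) => h2.
  have h3 : 0 <= L * `|x - y| by rewrite mulr_ge0.
  move: (L * `|x - y|) h1 h2 h3 => l h1 h2 h3.
  rewrite ler_norml; case: (leP b (g1 x)) => h4; case: (leP b (g1 y)) => h5;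
    apply/andP; split; lra.
- move=> x; have /andP[fa fb] := fab k0 Kk0.
  by rewrite le_min g1a (le_trans fa)//= ge_min lexx.
Qed.

Lemma ln_dist_le (a b p : R) : 0 < p -> p <= a -> p <= b ->
  `|ln a - ln b| <= `|a - b| / p.
Proof.
wlog ab : a b / b <= a => [h p0 pa pb|p0 pa pb].
  case: (leP b a) => [|/ltW] ab; first exact: h.
  by rewrite distrC (distrC a); exact: h.
have a0 : 0 < a by exact: lt_le_trans pa.
have b0 : 0 < b by exact: lt_le_trans pb.
rewrite !ger0_norm ?subr_ge0 ?ler_ln//.
rewrite -ln_div ?posrE//.
have -> : a / b = 1 + (a - b) / b by field; rewrite gt_eqF.
apply: le_trans (le_ln1Dx _) _.
  have : 0 <= (a - b) / b by rewrite divr_ge0 ?subr_ge0// ltW.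
  lra.
by rewrite ler_wpM2l ?subr_ge0// lef_pV2 ?posrE.
Qed.

Lemma esum_geometric_le (a q : R) : 0 <= a -> 0 <= q < 1 ->
  (\esum_(i in setT) (a * q ^+ i)%:E <= (a / (1 - q))%:E)%E.
Proof.
move=> a0 /andP[q0 q1].
have t0 i : 0 <= a * q ^+ i by rewrite mulr_ge0// exprn_ge0.
rewrite -nneseries_esumT; last by move=> i; rewrite lee_fin.
apply: lime_le; first by apply: is_cvg_nneseries => i _ _; rewrite lee_fin.
apply: nearW => n; rewrite sumEFin lee_fin -mulr_sumr ler_wpM2l//.
rewrite big_mkord; apply: geometric_sum_le.
by rewrite q0.
Qed.

End elementary_estimates.

(** * The forcing and the hyperbolic tangent *)

Section pinch.
Context {R : realType}.
Implicit Types x y : R.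

(** The forcing of the fibre maps, extended to an even function of period [1]
    on the line; it vanishes exactly at the integers. *)
Definition pinch x : R := `|sin (pi * x)|.

Lemma pinch_ge0 x : 0 <= pinch x. Proof. exact: normr_ge0. Qed.

Lemma pinch_le1 x : pinch x <= 1. Proof. exact: sin_max. Qed.

Lemma pinch0 : pinch 0 = 0. Proof. by rewrite /pinch mulr0 sin0 normr0. Qed.

Lemma pinchN x : pinch (- x) = pinch x.
Proof. by rewrite /pinch mulrN sinN normrN. Qed.

Lemma pinchD x y : pinch (x + y) <= pinch x + pinch y.
Proof.
rewrite /pinch mulrDr sinD (le_trans (ler_normD _ _))// !normrM.
by apply: lerD; rewrite ?ler_piMr ?ler_piMl ?cos_max.
Qed.

Lemma pinchB x y : pinch (x - y) <= pinch x + pinch y.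
Proof. by rewrite (le_trans (pinchD _ _))// pinchN. Qed.

Lemma pinch_nat x n : pinch (x + n%:R) = pinch x.
Proof.
elim: n => [|n <-]; first by rewrite addr0.
by rewrite /pinch -natr1 addrA mulrDr mulr1 sinDpi normrN.
Qed.

Lemma pinch_int x (k : int) : pinch (x + k%:~R) = pinch x.
Proof.
case: k => n; first exact: pinch_nat.
by rewrite NegzE mulrNz -[LHS](pinch_nat _ n.+1) subrK.
Qed.

Lemma norm_sin_le x : `|sin x| <= `|x|.
Proof.
wlog x0 : x / 0 <= x => [h|].
  by case: (leP 0 x) => [/h//|/ltW x0]; rewrite -normrN -sinN -[leRHS]normrN h// oppr_ge0.
have [|c _] := @MVT_segment R sin cos 0 x x0.
  exact/continuous_subspaceT/continuous_sin.
by rewrite sin0 !subr0 => ->; rewrite normrM ler_piMl// cos_max.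
Qed.

Lemma pi_le4 : pi <= 4 :> R.
Proof. by have := @pihalf_lt2 R; lra. Qed.

Lemma pinch_le x : pinch x <= 4 * `|x|.
Proof.
rewrite (le_trans (norm_sin_le _))// normrM ler_wpM2r// ger0_norm ?pi_ge0//.
exact: pi_le4.
Qed.

Lemma pinch_lipschitz x y : `|pinch x - pinch y| <= 4 * `|x - y|.
Proof.
have h u v : pinch u - pinch v <= 4 * `|u - v|.
  by rewrite lerBlDr -{1}(subrK v u) (le_trans (pinchD _ _))// lerD2r pinch_le.
by rewrite ler_norml lerNl opprB distrC h distrC h.
Qed.

(** For [x >= 0] and [y = pi x / 2], [sin (pi x) = 2 sin y cos y], where
    [sin y >= y cos (pi / 4)] and [cos y >= cos (pi / 4)]. *)
Lemma pinch_ge x : `|x| <= 1 / 2 -> `|x| <= pinch x.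
Proof.
wlog x0 : x / 0 <= x => [h|].
  by case: (leP 0 x) => [/h//|/ltW x0]; rewrite -normrN -pinchN; apply: h; rewrite oppr_ge0.
rewrite ger0_norm// => x2.
pose y : R := pi * x / 2.
have pi2 := @pi_ge2 R; have pi0 := @pi_gt0 R.
have y0 : 0 <= y by rewrite /y; nra.
have y4 : y <= pi / 4 by rewrite /y; nra.
have cos_ge u : 0 <= u <= pi / 4 -> 1 / 2 <= cos u ^+ 2 /\ 0 <= cos u.
  move=> /andP[u0 u4]; have c0 : 0 <= cos u by apply: cos_ge0_pihalf; apply/andP; split; lra.
  split=> //.
  have : 0 <= cos (u *+ 2).
    by rewrite mulr2n; apply: cos_ge0_pihalf; apply/andP; split; lra.
  by rewrite cos_mulr2n mulr2n; lra.
have [|c /andP[/=]] := @MVT_segment R sin cos 0 y y0.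
  exact/continuous_subspaceT/continuous_sin.
rewrite !bnd_simp => c0 cy; rewrite sin0 !subr0 => siny.
have [c2 cc0] : 1 / 2 <= cos c ^+ 2 /\ 0 <= cos c by apply: cos_ge; lra.
have [y2 cy0] : 1 / 2 <= cos y ^+ 2 /\ 0 <= cos y by apply: cos_ge; lra.
have cc : 1 / 2 <= cos c * cos y.
  rewrite leNgt; apply/negP => H.
  have : (cos c * cos y) ^+ 2 < (1 / 2) ^+ 2 by rewrite ltr_pXn2r ?nnegrE ?mulr_ge0.
  by rewrite exprMn; nra.
rewrite /pinch (le_trans _ (ler_norm _))//.
have -> : pi * x = y *+ 2 by rewrite /y mulr2n; lra.
rewrite sin_mulr2n siny mulr2n.
have : y / 2 <= cos y * (cos c * y) by nra.
have : 2 * x <= pi * x by nra.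
rewrite /y; lra.
Qed.

(** [pinch] is comparable to the distance to the integers, see also
    [pinch_le_dist_int]. *)
Lemma dist_int_le_pinch x : dist_int x <= pinch x.
Proof.
set k := Num.floor (x + 1 / 2).
rewrite (le_trans (dist_int_le x k))//.
rewrite -(pinch_int x (- k)) rmorphN; apply: pinch_ge.
have := floor_le (x + 1 / 2); have := floorD1_gt (x + 1 / 2).
by rewrite intrD1 -/k ler_norml; lra.
Qed.

Lemma pinch_le_dist_int x : pinch x <= 4 * dist_int x.
Proof.
rewrite -ler_pdivrMl// mulrC; apply: dist_int_ge => k.
rewrite ler_pdivrMr// mulrC -(pinch_int x (- k)) rmorphN.
exact: pinch_le.
Qed.

End pinch.

Section tanh.
Context {R : realType}.
Implicit Types x y : R.

Lemma tanhE x : tanh x = 1 - 2 / (expR (2 * x) + 1).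
Proof.
have -> : expR (2 * x) = expR x * expR x by rewrite -expRD; congr expR; lra.
rewrite /tanh expRN; have e0 := expR_gt0 x; field; rewrite ?gt_eqF//; nra.
Qed.

Lemma tanh0 : tanh 0 = 0 :> R.
Proof. by rewrite /tanh oppr0 subrr mul0r. Qed.

Lemma tanh_le x y : x <= y -> tanh x <= tanh y.
Proof.
move=> xy; rewrite !tanhE lerB// ler_pM2l// lef_pV2 ?posrE ?addr_gt0 ?expR_gt0//.
by rewrite lerD2r ler_expR; lra.
Qed.

Lemma tanh_ge0 x : 0 <= x -> 0 <= tanh x.
Proof. by move=> x0; rewrite -tanh0 tanh_le. Qed.

Lemma tanh_le1 x : tanh x <= 1.
Proof. by rewrite tanhE gerBl divr_ge0// addr_ge0// expR_ge0. Qed.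

Lemma tanh_lower x : 0 <= x -> x / (1 + x) <= tanh x.
Proof.
move=> x0; rewrite tanhE.
have -> : x / (1 + x) = 1 - 2 / ((1 + 2 * x) + 1) by field; rewrite !gt_eqF//; lra.
rewrite lerB// ler_pM2l// lef_pV2 ?posrE; have := expR_ge1Dx (2 * x); lra.
Qed.

Lemma tanh_gt0 x : 0 < x -> 0 < tanh x.
Proof. by move=> x0; rewrite (lt_le_trans _ (tanh_lower (ltW x0)))// divr_gt0//; lra. Qed.

(** The constant [2] instead of [1] lets the bound follow from
    [1 + u <= expR u] alone. *)
Lemma tanh_lipschitz x y : 0 <= x -> 0 <= y -> `|tanh x - tanh y| <= 2 * `|x - y|.
Proof.
wlog xy : x y / y <= x => [h x0 y0|x0 y0].
  case: (leP y x) => [/h|/ltW /h]; first exact.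
  by rewrite distrC (distrC x); exact.
rewrite !ger0_norm ?subr_ge0 ?tanh_le// !tanhE.
have a1 := expR_ge1Dx (2 * y); have a2 := expR_ge1Dx (2 * (y - x)).
set a := expR (2 * x); set b := expR (2 * y).
have a0 : 0 < a by exact: expR_gt0.
have b1 : 1 <= b by rewrite /b; lra.
have bE : b = a * expR (2 * (y - x)) by rewrite /a /b -expRD; congr expR; lra.
have ba : a - b <= a * (2 * (x - y)) by rewrite bE; nra.
have -> : 1 - 2 / (a + 1) - (1 - 2 / (b + 1)) = 2 * (a - b) / ((a + 1) * (b + 1)).
  by field; rewrite !gt_eqF//; lra.
rewrite ler_pdivrMr; last by nra.
have ab1 : 2 * a <= (a + 1) * (b + 1) by nra.
have t0 : 0 <= x - y by lra.
by have := ler_wpM2r t0 ab1; lra.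
Qed.

Lemma sinh_ge x : 0 <= x -> 2 * x <= expR x - expR (- x).
Proof.
move=> x0.
pose f u : R := expR u - expR (- u).
have df (u : R) : is_derive u 1 f (expR u + expR (- u)).
  apply: is_derive_eq; rewrite /GRing.scale/=. ring.
have [|c _] := @MVT_segment R f (fun u => expR u + expR (- u)) 0 x x0.
  apply: derivable_within_continuous => u _.
  by have [] := df u.
have -> : f 0 = 0 by rewrite /f oppr0 subrr.
rewrite !subr0 -/(f x) => ->.
rewrite ler_wpM2r// expRN; have := expR_gt0 c; set a := expR c => a0.
rewrite -(ler_pM2r a0) [leRHS]mulrDl mulVf ?gt_eqF//; have := sqr_ge0 (a - 1); lra.
Qed.

(** In logarithmic coordinates the derivative of [tanh] at [u] is
    [4 u / (expR (2 u) - expR (- 2 u))], so the hypothesis says that it is at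
    most [eta] on [[x, +oo[]. *)
Lemma ln_tanh_contract eta x y : 0 < x -> x <= y ->
  (forall u, x <= u -> 4 * u <= eta * (expR (2 * u) - expR (- (2 * u)))) ->
  ln (tanh y) - ln (tanh x) <= eta * (ln y - ln x).
Proof.
move=> x0 xy H.
pose g u : R := ln (expR u - expR (- u)) - ln (expR u + expR (- u)) - eta * ln u.
have gE u : 0 < u -> ln (tanh u) - eta * ln u = g u.
  move=> u0; rewrite /g /tanh ln_div ?posrE//.
    by have := sinh_ge (ltW u0); lra.
  by rewrite addr_gt0 ?expR_gt0.
suff : g y <= g x by rewrite -!gE//; [lra|exact: lt_le_trans xy].
pose dg u : R := (expR u + expR (- u)) / (expR u - expR (- u)) -
  (expR u - expR (- u)) / (expR u + expR (- u)) - eta / u.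
have dgP (u : R) : 0 < u -> is_derive u 1 g (dg u).
  move=> u0.
  have s0 : 0 < expR u - expR (- u) by have := sinh_ge (ltW u0); lra.
  have c0 : 0 < expR u + expR (- u) by rewrite addr_gt0 ?expR_gt0.
  rewrite /g.
  have d1 := is_derive1_ln s0; have d2 := is_derive1_ln c0; have d3 := is_derive1_ln u0.
  apply: is_derive_eq.
  rewrite /dg /= /GRing.scale/=; ring.
have [||c /andP[/=]] := @MVT_segment R g dg x y xy.
- by move=> u /andP[/=]; rewrite !bnd_simp => xu _; apply: dgP; exact: lt_trans xu.
- apply: derivable_within_continuous => u /andP[/=]; rewrite !bnd_simp => xu _.
  by have [] := dgP u (lt_le_trans x0 xu).
rewrite !bnd_simp => xc cy gyx; rewrite -subr_le0 gyx mulr_le0_ge0 ?subr_ge0//.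
have c0 : 0 < c by exact: lt_le_trans xc.
have := sinh_ge (ltW c0); rewrite /dg expRN.
have h1 : 4 * c <= eta * (expR c * expR c - (expR c * expR c)^-1).
  have := H c xc; rewrite expRN.
  by have -> : expR (2 * c) = expR c * expR c by rewrite -expRD; congr expR; lra.
have a0 := expR_gt0 c; move: h1 a0; set a := expR c => h1 a0 sh.
have a1 : 1 < a by rewrite -expR0 /a ltr_expR.
have aV : a * a^-1 = 1 by rewrite mulfV ?gt_eqF.
have P0 : 0 < (a - a^-1) * (a + a^-1) by nra.
have -> : (a + a^-1) / (a - a^-1) - (a - a^-1) / (a + a^-1) - eta / c =
  (4 * c - eta * (a * a - (a * a)^-1)) / ((a - a^-1) * (a + a^-1) * c).
  field; rewrite ?gt_eqF//; nra.
apply: mulr_le0_ge0; last by rewrite invr_ge0 mulr_ge0// ltW.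
by rewrite subr_le0.
Qed.

End tanh.

(** * Products of separated quantities *)

Section separated_products.
Context {R : realType}.
Variables (u : nat -> R) (e : R) (D : nat).
Hypothesis u01 : forall i, 0 <= u i <= 1.
Hypothesis e01 : 0 < e <= 1.
(** Two values of [u] at distance [k] in time cannot both be smaller than
    [e / k ^ D]. *)
Hypothesis sepu : forall i j, (i < j)%N -> e / (j - i)%:R ^+ D <= Num.max (u i) (u j).

Let w : R := e / 4 ^+ D.

Lemma sep_base_gt0 : 0 < w.
Proof. by rewrite /w divr_gt0 ?exprn_gt0//; case/andP: e01. Qed.

Lemma sep_base_le1 : w <= 1.
Proof.
rewrite /w ler_pdivrMr ?exprn_gt0// mul1r (@le_trans _ _ 1)//; first by case/andP: e01.
by rewrite exprn_ege1//; lra.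
Qed.

Lemma prod_nat_ge0 m n (P : pred nat) : 0 <= \prod_(m <= i < n | P i) u i.
Proof. by apply: prodr_ge0 => i _; case/andP: (u01 i). Qed.

Lemma prod_nat_le1 m n (P : pred nat) : \prod_(m <= i < n | P i) u i <= 1.
Proof. by apply: prodr_ile1 => i _. Qed.

(** The product over a window of length [2 ^ l] with one factor [u j] left out
    is at least exponential in the length. By induction: of the two factors left
    out in the halves of the window, the larger one is put back, and it is
    bounded below by the separation. The weight [(2 ^ l) ^ D] absorbs the
    polynomial losses. *)
Lemma window_prod_lower l a : exists2 j, (a <= j < a + 2 ^ l)%N &
  w ^+ (2 ^ l).-1 * (2 ^ l)%:R ^+ D <= \prod_(a <= i < a + 2 ^ l | i != j) u i.
Proof.
elim: l a => [|l IH] a.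
  exists a; first by rewrite leqnn addn1 ltnS leqnn.
  rewrite expn0 expr0 mul1r expr1n big_mkcond addn1 big_nat1 eqxx//.
have [j1 /andP[aj1 j1m] h1] := IH a.
have [j2 /andP[mj2 j2b] h2] := IH (a + 2 ^ l)%N.
set m := (a + 2 ^ l)%N in j1m h1 mj2 j2b h2.
have eb : (a + 2 ^ l.+1 = m + 2 ^ l)%N by rewrite expnS mul2n -addnn addnA.
rewrite {}eb; set b := (m + 2 ^ l)%N in j2b h2 *.
have am : (a <= m)%N by rewrite leq_addr.
have mb : (m <= b)%N by rewrite leq_addr.
have j12 : (j1 < j2)%N by exact: leq_trans mj2.
set P1 := \prod_(a <= i < m | i != j1) u i in h1.
set P2 := \prod_(m <= i < b | i != j2) u i in h2.
have full1 : \prod_(a <= i < m) u i = u j1 * P1.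
  by rewrite (bigD1_seq j1) ?mem_index_iota ?aj1 ?iota_uniq.
have full2 : \prod_(m <= i < b) u i = u j2 * P2.
  by rewrite (bigD1_seq j2) ?mem_index_iota ?mj2 ?iota_uniq.
have off1 : \prod_(a <= i < m | i != j2) u i = u j1 * P1.
  rewrite -full1 big_nat_cond [RHS]big_nat_cond; apply: eq_bigl => i.
  by rewrite andbT; apply: andb_idr => /andP[_ im]; rewrite neq_ltn (leq_trans im).
have off2 : \prod_(m <= i < b | i != j1) u i = u j2 * P2.
  rewrite -full2 big_nat_cond [RHS]big_nat_cond; apply: eq_bigl => i.
  by rewrite andbT; apply: andb_idr => /andP[mi _]; rewrite neq_ltn (leq_trans j1m) ?orbT.
have key x : e / (2 ^ l.+1)%:R ^+ D <= x ->
    w ^+ (2 ^ l.+1).-1 * (2 ^ l.+1)%:R ^+ D <= P1 * (x * P2).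
  move=> hx.
  have p0 : 0 < (2 ^ l)%:R ^+ D :> R by rewrite exprn_gt0// ltr0n expn_gt0.
  have t0 : 0 < 2 ^+ D :> R by rewrite exprn_gt0.
  have w0 := sep_base_gt0.
  have pE : (2 ^ l.+1)%:R ^+ D = (2 ^ l)%:R ^+ D * 2 ^+ D :> R.
    by rewrite -exprMn expnS natrM mulrC.
  rewrite {}pE in hx *.
  have -> : (2 ^ l.+1).-1 = ((2 ^ l).-1 + (2 ^ l).-1).+1.
    by rewrite expnS mul2n -addnn -{1 2}(prednK (expn_gt0 2 l)) addnS.
  rewrite exprS exprD.
  set W := w ^+ (2 ^ l).-1; set p := (2 ^ l)%:R ^+ D; set t : R := 2 ^+ D.
  have W0 : 0 < W by rewrite exprn_gt0.
  have wE : w = e / (t * t) by rewrite /w /t -exprMn; congr (_ / _ ^+ _); lra.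
  have -> : w * (W * W) * (p * t) = (W * p) * ((e / (p * t)) * (W * p)).
    by rewrite wE; field; rewrite !gt_eqF.
  have e0 : 0 < e by case/andP: e01.
  have Wp0 : 0 <= W * p by rewrite mulr_ge0// ltW.
  have ept0 : 0 <= e / (p * t) by rewrite divr_ge0// ?mulr_ge0// ltW.
  apply: (ler_pM Wp0 _ h1); first by rewrite mulr_ge0.
  exact: (ler_pM ept0 Wp0 hx h2).
have sep : e / (2 ^ l.+1)%:R ^+ D <= Num.max (u j1) (u j2).
  apply: le_trans (sepu j12); rewrite ler_pM2l; last by case/andP: e01.
  have d0 : (0 < j2 - j1)%N by rewrite subn_gt0.
  rewrite lef_pV2 ?posrE ?exprn_gt0 ?ltr0n ?expn_gt0// lerXn2r ?nnegrE ?ler0n//.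
  rewrite ler_nat expnS mul2n -addnn; move: (aj1) (j2b); rewrite /b /m; lia.
case: (leP (u j1) (u j2)) sep => _ sep.
- exists j1; first by rewrite aj1 (leq_trans j1m).
  by rewrite (big_cat_nat am mb)/= off2; exact: key.
- exists j2; first by rewrite j2b (leq_trans am).
  by rewrite (big_cat_nat am mb)/= off1 -/P2 (mulrC (u j1)) -mulrA; exact: key.
Qed.

(** The bound [d] takes care of the one factor that [window_prod_lower] leaves
    out. *)
Lemma prod_lower k d : 0 <= d <= 1 -> (forall i, (i < k)%N -> d <= u i) ->
  w ^+ (2 * k) * d <= \prod_(i < k) u i.
Proof.
move=> /andP[d0 d1]; case: k => [|k] hd; first by rewrite big_ord0 muln0 expr0 mul1r.
have w0 := sep_base_gt0; have w1 := sep_base_le1.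
pose l := (trunc_log 2 k.+1).+1.
have /andP[tk kt] : (2 ^ (trunc_log 2 k.+1) <= k.+1 < 2 ^ l)%N by exact: trunc_log_bounds.
have l2 : (2 ^ l <= 2 * k.+1)%N by rewrite expnS leq_mul2l.
have [j /= _] := window_prod_lower l 0; rewrite add0n => hj.
have {}hj : w ^+ (2 * k.+1) <= \prod_(0 <= i < k.+1 | i != j) u i.
  apply: (@le_trans _ _ (\prod_(0 <= i < 2 ^ l | i != j) u i)).
    apply: le_trans hj; rewrite -[leLHS]mulr1; apply: ler_pM => //.
    - by rewrite exprn_ge0// ltW.
    - by rewrite ler_wiXn2l ?(ltW w0)// (leq_trans (leq_pred _)).
    - by rewrite exprn_ege1// ler1n expn_gt0.
  rewrite (big_cat_nat (leq0n _) (ltnW kt))/= ler_piMr ?prod_nat_ge0//.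
  exact: prod_nat_le1.
rewrite -(big_mkord xpredT) mulrC; have [jk|kj] := ltnP j k.+1.
  rewrite (bigD1_seq j) ?mem_index_iota ?iota_uniq//=.
  by apply: ler_pM => //; [rewrite exprn_ge0// ltW | exact: hd].
apply: (le_trans _ (le_trans hj _)); first by rewrite ler_piMl// exprn_ge0// ltW.
rewrite big_nat_cond [leRHS]big_nat_cond le_eqVlt; apply/orP; left; apply/eqP.
by apply: eq_bigl => i; rewrite andbT; apply: andb_idr => ik; apply/eqP; lia.
Qed.

End separated_products.

(** * Orbits in the fibres *)

Section fiber_dynamics.
Context {R : realType}.
Variables (kappa rho : R).
Implicit Types x y z : R.

(** [fiber_orbit x z n] is the second coordinate of the [n]-th image of
    [(x, z)], where the first coordinate is lifted to the line. *)
Fixpoint fiber_orbit x z (n : nat) : R :=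
  if n is m.+1 then tanh (kappa * fiber_orbit x z m) * pinch (x + m%:R * rho)
  else z.

(** The [n]-th image of the constant line [1]. These lines decrease with [n],
    and [upper_bounding_graphE] identifies their infimum [upper_limit] with the
    upper bounding graph. *)
Definition upper_line (n : nat) x : R := fiber_orbit (x - n%:R * rho) 1 n.

Definition upper_limit x : R := inf (range (upper_line^~ x)).

Lemma upper_lineS n x :
  upper_line n.+1 x = tanh (kappa * upper_line n (x - rho)) * pinch (x - rho).
Proof.
have e : x - n.+1%:R * rho = x - rho - n%:R * rho by rewrite -natr1; ring.
by rewrite /upper_line e /= subrK.
Qed.

Lemma upper_line_shift n k x : (k <= n)%N ->
  fiber_orbit (x - n%:R * rho) 1 (n - k) = upper_line (n - k) (x - k%:R * rho).
Proof.
move=> kn; have e : x - n%:R * rho = x - k%:R * rho - (n - k)%:R * rho by rewrite natrB//; ring.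
by rewrite /upper_line e.
Qed.

Hypothesis kappa_gt0 : 0 < kappa.

Lemma fiber_orbit_ge0 x z n : 0 <= z -> 0 <= fiber_orbit x z n.
Proof.
move=> z0; elim: n => [//|n IH] /=.
by rewrite mulr_ge0 ?pinch_ge0// tanh_ge0// mulr_ge0// ltW.
Qed.

Lemma fiber_orbit_le1 x z n : 0 <= z <= 1 -> fiber_orbit x z n <= 1.
Proof.
move=> /andP[z0 z1]; case: n => [//|n] /=.
by rewrite mulr_ile1 ?pinch_ge0 ?pinch_le1 ?tanh_le1// tanh_ge0// mulr_ge0 ?fiber_orbit_ge0// ltW.
Qed.

Lemma upper_line_ge0 n x : 0 <= upper_line n x.
Proof. exact: fiber_orbit_ge0. Qed.

Lemma upper_line_le1 n x : upper_line n x <= 1.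
Proof. by apply: fiber_orbit_le1; rewrite ler01 lexx. Qed.

Lemma has_inf_upper_line x : has_inf (range (upper_line^~ x)).
Proof.
split; first by exists 1, 0%N.
by exists 0 => _ [n _ <-]; exact: upper_line_ge0.
Qed.

Lemma upper_limit_le n x : upper_limit x <= upper_line n x.
Proof. by apply: ge_inf; [case: (has_inf_upper_line x) | exists n]. Qed.

Lemma upper_limit_ge x a : (forall n, a <= upper_line n x) -> a <= upper_limit x.
Proof.
move=> h; apply: lb_le_inf; first by case: (has_inf_upper_line x).
by move=> _ [n _ <-].
Qed.

Lemma upper_limit_ge0 x : 0 <= upper_limit x.
Proof. by apply: upper_limit_ge => n; exact: upper_line_ge0. Qed.

Lemma upper_limit_le1 x : upper_limit x <= 1.
Proof. exact: le_trans (upper_limit_le 0 x) _. Qed.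

Lemma upper_line_int n x (k : int) : upper_line n (x + k%:~R) = upper_line n x.
Proof.
elim: n x => [//|n IH] x; rewrite !upper_lineS.
have -> : x + k%:~R - rho = x - rho + k%:~R by ring.
by rewrite IH pinch_int.
Qed.

Lemma upper_limit_int x (k : int) : upper_limit (x + k%:~R) = upper_limit x.
Proof.
have e : upper_line^~ (x + k%:~R) = upper_line^~ x.
  by apply/funext => n; exact: upper_line_int.
by rewrite /upper_limit e.
Qed.

Lemma upper_limit_invariant x :
  upper_limit (x + rho) = tanh (kappa * upper_limit x) * pinch x.
Proof.
have kl0 : 0 <= kappa * upper_limit x by rewrite mulr_ge0 ?upper_limit_ge0// ltW.
apply/eqP; rewrite eq_le; apply/andP; split; last first.
  apply: upper_limit_ge => -[|n].
    by rewrite mulr_ile1 ?pinch_ge0 ?pinch_le1 ?tanh_le1// tanh_ge0.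
  by rewrite upper_lineS addrK ler_wpM2r ?pinch_ge0// tanh_le// ler_pM2l// upper_limit_le.
apply/ler_addgt0Pr => e e0.
pose d := e / (2 * kappa).
have d0 : 0 < d by rewrite divr_gt0// mulr_gt0.
have [_ [n _ <-] hn] : exists2 y, range (upper_line^~ x) y & y < upper_limit x + d.
  exact: inf_adherent (has_inf_upper_line x).
apply: le_trans (upper_limit_le n.+1 _) _; rewrite upper_lineS addrK.
apply: (@le_trans _ _ ((tanh (kappa * upper_limit x) + e) * pinch x)).
  rewrite ler_wpM2r ?pinch_ge0// -lerBlDl (le_trans (ler_norm _))//.
  rewrite (le_trans (tanh_lipschitz _ _))// ?mulr_ge0 ?upper_line_ge0 ?(ltW kappa_gt0)//.
  rewrite -mulrBr normrM (ger0_norm (ltW kappa_gt0)) ger0_norm ?subr_ge0 ?upper_limit_le//.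
  rewrite mulrA -ler_pdivlMl ?mulr_gt0// mulrC -/d; lra.
by rewrite mulrDl lerD2l ler_piMr ?pinch_le1// ltW.
Qed.

End fiber_dynamics.

(** * Contraction over tame points *)

Section contraction.
Context {R : realType}.
Variables (kappa rho sg : R).
Hypothesis sg01 : 0 < sg <= 1.

(** The decay rate [sg] of the products of the forcing determines all the
    constants. The contraction rate is [eta = (sg / 2) ^ 2], so that contracting
    during half of the time already beats the decay [sg]; [M] is the threshold
    for [kappa z] above which the fibre map contracts by [eta], and [gain] the
    expansion below the threshold. *)
Let eta : R := sg ^+ 2 / 4.
Let M : R := 16 / sg ^+ 2.
Let gain : R := kappa / (1 + M).

Hypothesis kappa_large : (4 / sg ^+ 2) ^+ 4 * (1 + 16 / sg ^+ 2) <= kappa.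

Lemma eta_gt0 : 0 < eta.
Proof. by rewrite /eta divr_gt0// exprn_gt0//; case/andP: sg01. Qed.

Lemma eta_le1 : eta <= 1.
Proof.
rewrite /eta ler_pdivrMr// mul1r (@le_trans _ _ 1)//; last by lra.
by rewrite exprn_ile1//; case/andP: sg01 => /ltW.
Qed.

Lemma threshold_eta : M = 4 / eta.
Proof. by rewrite /M /eta; field; rewrite gt_eqF//; case/andP: sg01. Qed.

Lemma threshold_ge1 : 1 <= M.
Proof.
rewrite threshold_eta ler_pdivlMr ?eta_gt0// mul1r.
by have := eta_le1; lra.
Qed.

Lemma gain_ge : (eta^-1) ^+ 4 <= gain.
Proof.
have M1 := threshold_ge1.
rewrite /gain ler_pdivlMr; last by lra.
by rewrite /eta invf_div.
Qed.

Lemma gain_ge1 : 1 <= gain.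
Proof.
apply: le_trans gain_ge; rewrite exprn_ege1// invf_ge1 ?eta_gt0//.
exact: eta_le1.
Qed.

Lemma kappa_gt0 : 0 < kappa.
Proof.
have M1 := threshold_ge1.
have := gain_ge1; rewrite /gain ler_pdivlMr; lra.
Qed.

Let kappa_ge0 : 0 <= kappa. Proof. exact: ltW kappa_gt0. Qed.

(** At low points the fibre map expands by [gain] times the forcing, see
    [step_low]; at the other ones it contracts logarithmic distances by [eta],
    see [ln_step_contract]. *)
Definition low z : bool := kappa * z < M.

Lemma step_low z a : 0 <= z -> 0 <= a -> low z ->
  gain * z * a <= tanh (kappa * z) * a.
Proof.
move=> z0 a0 zM; rewrite ler_wpM2r//.
have M1 := threshold_ge1; have kz0 : 0 <= kappa * z by rewrite mulr_ge0.
apply: le_trans (tanh_lower kz0); rewrite /gain mulrAC ler_wpM2l//.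
by rewrite lef_pV2 ?posrE; move: zM; rewrite /low; lra.
Qed.

Lemma step_high z a : 0 <= a -> ~~ low z -> a / 2 <= tanh (kappa * z) * a.
Proof.
rewrite /low -leNgt => a0 zM; have M1 := threshold_ge1.
rewrite mulrC ler_wpM2r//.
have kz1 : 1 <= kappa * z by lra.
apply: le_trans (tanh_lower _); last by lra.
rewrite ler_pdivlMr; lra.
Qed.

(** The number of times in [[m, n[] at which the orbit of [(x, z)] is low. *)
Definition low_count x z m n : nat :=
  (\sum_(m <= i < n) low (fiber_orbit kappa rho x z i))%N.

(** As heights are at most [1], this bounds the number of low times in terms of
    the forcing along the orbit. The factor [1 / 2] is what a high step may
    lose. *)
Lemma orbit_growth x z m k : 0 <= z <= 1 ->
  gain ^+ low_count x z m (m + k) * (1 / 2) ^+ k *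
    (\prod_(m <= i < m + k) pinch (x + i%:R * rho)) * fiber_orbit kappa rho x z m
  <= fiber_orbit kappa rho x z (m + k).
Proof.
move=> z01; have z0 : 0 <= z by case/andP: z01.
have g1 := gain_ge1; have g0 : 0 <= gain by lra.
elim: k => [|k IH].
  by rewrite addn0 /low_count !big_geq// !expr0 !mul1r.
set y := fiber_orbit kappa rho x z (m + k) in IH.
have y0 : 0 <= y by exact: (fiber_orbit_ge0 rho kappa_gt0 x).
have y1 : y <= 1 by exact: (fiber_orbit_le1 rho kappa_gt0 x).
rewrite addnS /low_count !big_nat_recr ?leq_addr//= -/y -/(low_count x z m (m + k)).
set a := pinch _; have a0 : 0 <= a by exact: pinch_ge0.
set P := \prod_(m <= i < m + k) _ in IH *.
set L := low_count x z m (m + k) in IH *.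
set B := gain ^+ L * (1 / 2) ^+ k * P * fiber_orbit kappa rho x z m in IH.
have P0 : 0 <= P by apply: prodr_ge0 => i _; exact: pinch_ge0.
have B0 : 0 <= B.
  rewrite /B !mulr_ge0 ?exprn_ge0//.
  exact: (fiber_orbit_ge0 rho kappa_gt0 x).
have [ly|hy] := boolP (low y).
  apply: le_trans (step_low y0 a0 ly).
  have -> : gain ^+ (L + true) * (1 / 2) ^+ k.+1 * (P * a) * fiber_orbit kappa rho x z m =
    gain * (B / 2) * a by rewrite /B addn1 !exprS; field.
  rewrite ler_wpM2r// ler_wpM2l//.
  by apply: le_trans IH; rewrite ler_pdivrMr//; lra.
apply: le_trans (step_high a0 hy).
have -> : gain ^+ (L + false) * (1 / 2) ^+ k.+1 * (P * a) * fiber_orbit kappa rho x z m =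
  B * (a / 2) by rewrite /B addn0 !exprS; field.
apply: ler_piMl; last exact: le_trans IH y1.
by rewrite divr_ge0.
Qed.

(** Along the backward orbit of a point of [tame q], the products of the forcing
    decay at most like [q * sg ^ k]. *)
Definition tame (q : R) : set R :=
  [set x | forall k : nat, q * sg ^+ k <= \prod_(i < k) pinch (x - i.+1%:R * rho)].

(** The constant is multiplied by the exact ratio of [sg] to the first factor
    and not just by [sg], as in [tame_shift]; this is what makes the induction
    in [upper_line_tame_ge] close. *)
Lemma tame_shift1 q x : 0 < q -> tame q x ->
  tame (q * sg / pinch (x - rho)) (x - rho).
Proof.
case/andP: sg01 => s0 _ q0 tx k.
have := tx 1%N; rewrite big_ord1 expr1 mul1r => p1.
have p0 : 0 < pinch (x - rho) by rewrite (lt_le_trans _ p1)// mulr_gt0.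
have := tx k.+1; rewrite big_ord_recl /= mul1r => h.
rewrite mulrAC ler_pdivrMr// [leRHS]mulrC -mulrA -exprS.
apply: le_trans h _; rewrite le_eqVlt; apply/orP; left; apply/eqP; congr (_ * _).
by apply: eq_bigr => i _; congr pinch; rewrite /bump /= add1n -[in LHS]natr1; ring.
Qed.

Lemma tame_shift q x k : tame q x -> tame (q * sg ^+ k) (x - k%:R * rho).
Proof.
move=> tx l; have := tx (k + l)%N; rewrite exprD mulrA big_split_ord /= => h.
have -> : \prod_(i < l) pinch (x - k%:R * rho - i.+1%:R * rho) =
    \prod_(i < l) pinch (x - (k + i).+1%:R * rho).
  by apply: eq_bigr => i _; congr pinch; rewrite -addnS natrD; ring.
apply: le_trans h _; rewrite ler_piMl//.
  by apply: prodr_ge0 => i _; exact: pinch_ge0.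
by apply: prodr_ile1 => i _; rewrite pinch_ge0 pinch_le1.
Qed.

Lemma tame_le1 q x : tame q x -> q <= 1.
Proof. by move=> /(_ 0%N); rewrite big_ord0 expr0 mulr1. Qed.

Lemma tame_factor q x k : tame q x -> q * sg ^+ k.+1 <= pinch (x - k.+1%:R * rho).
Proof.
move=> /(_ k.+1) h; apply: le_trans h _; rewrite big_ord_recr /= ler_piMl ?pinch_ge0//.
by apply: prodr_ile1 => i _; rewrite pinch_ge0 pinch_le1.
Qed.

Lemma upper_line_tame_ge q x n : 0 < q -> tame q x ->
  q * (sg / 2) <= upper_line kappa rho n x.
Proof.
case/andP: (sg01) => s0 s1.
elim: n q x => [|n IH] q x q0 tx.
  have q1 := tame_le1 tx.
  by rewrite -[upper_line _ _ _ _]/(1 : R) mulr_ile1//; lra.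
have := tame_factor 0 tx; rewrite expr1 mul1r => p1.
have p0 : 0 < pinch (x - rho) by rewrite (lt_le_trans _ p1)// mulr_gt0.
have q'0 : 0 < q * sg / pinch (x - rho) by rewrite divr_gt0// mulr_gt0.
have {IH} := IH _ _ q'0 (tame_shift1 q0 tx).
have := upper_line_ge0 rho kappa_gt0 n (x - rho).
rewrite upper_lineS; set y := upper_line _ _ _ _; set a := pinch _ in p1 p0 *.
move=> y0 yl.
have [ly|hy] := boolP (low y); last first.
  apply: le_trans (step_high (ltW p0) hy); lra.
apply: le_trans (step_low y0 (ltW p0) ly).
have gs : 1 <= gain * sg.
  have g1 := gain_ge; rewrite -ler_pdivrMr//.
  apply: le_trans g1; have e1 : 1 <= eta^-1 by rewrite invf_ge1 ?eta_gt0// eta_le1.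
  apply: (@le_trans _ _ eta^-1); last by rewrite exprS ler_peMr ?exprn_ege1//; lra.
  rewrite mul1r /eta invf_div ler_pdivlMr ?exprn_gt0// expr2 mulKf ?gt_eqF//; lra.
have : q * sg * (sg / 2) <= y * a.
  by move: yl; rewrite mulrAC ler_pdivrMr.
have g0 := gain_ge1; move=> h; rewrite -(mulrA gain).
have : gain * (q * sg * (sg / 2)) <= gain * (y * a) by rewrite ler_wpM2l//; lra.
move=> h2; apply: le_trans h2.
have -> : gain * (q * sg * (sg / 2)) = (gain * sg) * (q * (sg / 2)) by ring.
by rewrite ler_peMl// mulr_ge0//; lra.
Qed.

(** Since [gain >= eta ^ -4], a bound on [gain ^ B] by a power of [eta ^ -1]
    bounds [4 B]. *)
Lemma pow_low_count B K N (A : R) : 0 < A -> gain ^+ B * (1 / 2) ^+ K * A <= 1 ->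
  2 ^+ K / A <= (eta^-1) ^+ N -> (4 * B <= N)%N.
Proof.
move=> A0 h1 h2; have e0 := eta_gt0.
have eV1 : 1 < eta^-1.
  rewrite invf_gt1// /eta ltr_pdivrMr// mul1r.
  by rewrite (@le_lt_trans _ _ 1) ?exprn_ile1//; case/andP: sg01 => [/ltW]//; lra.
rewrite -(ler_eXn2l eV1) (le_trans _ h2)// exprM.
rewrite (@le_trans _ _ (gain ^+ B))//.
  have g1 := gain_ge1; have g0 : 0 <= gain by lra.
  by apply: lerXn2r; rewrite ?nnegrE ?exprn_ge0 ?invr_ge0 ?(ltW e0)// gain_ge.
rewrite ler_pdivlMr//.
have t0 : 0 < 2 ^+ K :> R by rewrite exprn_gt0.
have -> : gain ^+ B * A = gain ^+ B * (1 / 2) ^+ K * A * 2 ^+ K.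
  by rewrite [(1 / 2) ^+ K]expr_div_n expr1n; field; rewrite gt_eqF.
by rewrite ler_piMl// ltW.
Qed.

(** Up to a constant, a tame point is low during at most a quarter of any final
    segment of time. *)
Lemma low_count_tame q x m n K : 0 < q -> tame q x -> (K <= n)%N ->
  2 / (q ^+ 2 * sg) <= (eta^-1) ^+ m ->
  (4 * low_count (x - n%:R * rho) 1 (n - K) n <= m + K)%N.
Proof.
case/andP: (sg01) => s0 s1 q0 tx Kn hm.
have z01 : 0 <= (1 : R) <= 1 by rewrite ler01 lexx.
have := @orbit_growth (x - n%:R * rho) 1 (n - K) K z01.
rewrite (subnK Kn) big_rev_mkord subKn// upper_line_shift//.
set B := low_count _ _ _ _ => h.
have := fiber_orbit_le1 rho kappa_gt0 (x - n%:R * rho) n z01 => /(le_trans h) {}h.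
have P1 := tx K.
have P2 := upper_line_tame_ge (n - K) (mulr_gt0 q0 (exprn_gt0 K s0)) (tame_shift K tx).
have PE : \prod_(k < K) pinch (x - n%:R * rho + (n - k.+1)%:R * rho) =
    \prod_(k < K) pinch (x - k.+1%:R * rho).
  apply: eq_bigr => k _; congr pinch; rewrite natrB; last exact: leq_trans (ltn_ord k) Kn.
  by ring.
rewrite {}PE in h.
have q'0 : 0 < q * sg ^+ K by rewrite mulr_gt0// exprn_gt0.
have A0 : 0 < (q * sg ^+ K) * (q * sg ^+ K * (sg / 2)) by do 2!apply: mulr_gt0 => //; lra.
apply: (pow_low_count A0 (K := K)).
  apply: le_trans h; rewrite -[leRHS]mulrA; apply: ler_wpM2l.
    by rewrite mulr_ge0// exprn_ge0//; have := gain_ge1; lra.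
  apply: ler_pM => //; first exact: ltW.
  by rewrite mulr_ge0// ?(ltW q'0)//; lra.
rewrite exprD.
have -> : 2 ^+ K / (q * sg ^+ K * (q * sg ^+ K * (sg / 2))) =
    2 / (q ^+ 2 * sg) * (2 / sg ^+ 2) ^+ K.
  rewrite expr_div_n -exprM mulnC exprM; field; rewrite !gt_eqF// exprn_gt0//.
apply: ler_pM => //.
- by rewrite divr_ge0// mulr_ge0 ?exprn_ge0// ltW.
- by rewrite exprn_ge0// divr_ge0// exprn_ge0// ltW.
rewrite lerXn2r ?nnegrE ?invr_ge0 ?(ltW eta_gt0)// ?divr_ge0 ?exprn_ge0 ?(ltW s0)//.
by rewrite /eta invf_div ler_pM2r ?invr_gt0 ?exprn_gt0//; lra.
Qed.

(** Distances of logarithms of heights are never expanded; the forcing enters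
    only through the additive term. *)
Lemma ln_step_contract y z a b : 0 < y -> 0 < z -> 0 < a -> 0 < b ->
  `|ln (tanh (kappa * y) * a) - ln (tanh (kappa * z) * b)| <=
  (if low y || low z then 1 else eta) * `|ln y - ln z| + `|ln a - ln b|.
Proof.
wlog yz : y z a b / z <= y => [h y0 z0 a0 b0|y0 z0 a0 b0].
  case: (leP z y) => [|/ltW] yz; first exact: h.
  by rewrite distrC orbC (distrC (ln y)) (distrC (ln a)); exact: h.
have k0 := kappa_gt0; have ky0 : 0 < kappa * y by rewrite mulr_gt0.
have kz0 : 0 < kappa * z by rewrite mulr_gt0.
have lnt u v : 0 < u -> 0 < v -> ln (tanh u * v) = ln (tanh u) + ln v.
  by move=> u0 v0; rewrite lnM ?posrE ?tanh_gt0.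
rewrite !lnt//.
have -> : ln (tanh (kappa * y)) + ln a - (ln (tanh (kappa * z)) + ln b) =
  (ln (tanh (kappa * y)) - ln (tanh (kappa * z))) + (ln a - ln b) by ring.
apply: le_trans (ler_normD _ _) _; rewrite lerD2r.
have kyz : kappa * z <= kappa * y by rewrite ler_pM2l.
rewrite !ger0_norm ?subr_ge0 ?ler_ln ?posrE ?tanh_gt0 ?tanh_le//.
have -> : ln y - ln z = ln (kappa * y) - ln (kappa * z) by rewrite !lnM ?posrE//; ring.
apply: ln_tanh_contract => // u zu.
have u0 : 0 < u by exact: lt_le_trans zu.
case: ifPn => [_|].
  by rewrite mul1r (le_trans _ (sinh_ge _))//; lra.
rewrite negb_or /low -!leNgt => /andP[_ Mz].
have e1 : expR (- (2 * u)) <= 1 by rewrite expR_le1; lra.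
have e2 : 1 + (2 * u) ^+ 2 / 2 <= expR (2 * u) by apply: (@expR_ge1Dxn _ _ 1); lra.
have Mu : 4 <= eta * u.
  have := le_trans Mz zu.
  by rewrite threshold_eta ler_pdivrMr ?eta_gt0// mulrC.
have e0 := eta_gt0.
have : eta * (2 * u ^+ 2) <= eta * (expR (2 * u) - expR (- (2 * u))).
  by rewrite ler_pM2l//; lra.
apply: le_trans; nra.
Qed.

(** The Lipschitz constant on [tame q]. The exponent [m] is chosen such that
    [eta ^ - m] exceeds [2 / (q ^ 2 * sg)]; it measures how long [q] delays the
    contraction. *)
Definition tame_lipschitz_const (q : R) (m : nat) : R :=
  8 / (q * sg * (sg / 2) ^+ m).

(** Two tame points are simultaneously high at least half of the time, and
    [eta ^ (1 / 2) = sg / 2]. *)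
Lemma prod_contraction_le q x y m n j : 0 < q -> tame q x -> tame q y ->
  2 / (q ^+ 2 * sg) <= (eta^-1) ^+ m -> (j < n)%N ->
  (\prod_(j.+1 <= i < n)
    (if low (fiber_orbit kappa rho (x - n%:R * rho) 1 i) ||
        low (fiber_orbit kappa rho (y - n%:R * rho) 1 i) then 1 else eta))
  <= (sg / 2) ^+ (n - j.+1) / (sg / 2) ^+ m.
Proof.
move=> q0 tx ty hm jn; have [s0 s1] : 0 < sg /\ sg <= 1 by apply/andP.
have z0 : 0 < sg / 2 by lra.
set X := fiber_orbit _ _ _ _; set Y := fiber_orbit _ _ _ _.
pose g i := (~~ (low (X i) || low (Y i)) : nat).
rewrite (eq_bigr (fun i => eta ^+ g i)); last first.
  by move=> i _; rewrite /g; case: ifP.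
rewrite -expr_sum.
have nj : (n - (n - j.+1) = j.+1)%N by rewrite subKn.
have := low_count_tame q0 tx (leq_subr j.+1 n) hm.
have := low_count_tame q0 ty (leq_subr j.+1 n) hm.
rewrite nj /low_count -/X -/Y => bY bX.
set G := (\sum_(j.+1 <= i < n) g i)%N.
have tot : (n - j.+1 <= G + (\sum_(j.+1 <= i < n) low (X i) + \sum_(j.+1 <= i < n) low (Y i)))%N.
  rewrite /G -!big_split/= -[leqLHS]muln1 -sum_nat_const_nat; apply: leq_sum => i _.
  by rewrite /g; case: low; case: low.
rewrite ler_pdivlMr ?exprn_gt0//.
have -> : eta = (sg / 2) ^+ 2 by rewrite /eta expr_div_n; congr (_ / _); ring.
rewrite -exprM -exprD ler_wiXn2l//; [exact: ltW | by lra |].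
lia.
Qed.

(** The difference of the forcings [k] steps before the end costs at most
    [4 |x - y| / (q * sg ^ k)] and is contracted afterwards by about
    [(sg / 2) ^ k]; the sum is geometric, uniformly in [n]. *)
Lemma ln_upper_line_lipschitz q x y m n : 0 < q -> tame q x -> tame q y ->
  2 / (q ^+ 2 * sg) <= (eta^-1) ^+ m ->
  `|ln (upper_line kappa rho n x) - ln (upper_line kappa rho n y)| <=
  tame_lipschitz_const q m * `|x - y|.
Proof.
move=> q0 tx ty hm; have [s0 s1] : 0 < sg /\ sg <= 1 by apply/andP.
have z0 : 0 < sg / 2 by lra.
set X := fiber_orbit kappa rho (x - n%:R * rho) 1.
set Y := fiber_orbit kappa rho (y - n%:R * rho) 1.
have shiftE w i : (i < n)%N ->
    w - n%:R * rho + i%:R * rho = w - (n - i.+1).+1%:R * rho.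
  by move=> ni; rewrite -subSn// subSS natrB ?(ltnW ni)//; ring.
have fac w i : tame q w -> (i < n)%N ->
    q * sg ^+ (n - i.+1).+1 <= pinch (w - n%:R * rho + i%:R * rho).
  by move=> tw ni; rewrite shiftE//; exact: tame_factor.
have fac0 i : 0 < q * sg ^+ i by rewrite mulr_gt0// exprn_gt0.
have pos w i : tame q w -> (i <= n)%N -> 0 < fiber_orbit kappa rho (w - n%:R * rho) 1 i.
  move=> tw; elim: i => [//|i IH] ni /=; rewrite mulr_gt0//.
    by rewrite tanh_gt0// mulr_gt0 ?kappa_gt0// IH// ltnW.
  by apply: lt_le_trans (fac _ _ tw ni).
pose d i := `|ln (X i) - ln (Y i)|.
pose h i := if low (X i) || low (Y i) then 1 else eta.
pose f i := 4 * `|x - y| / (q * sg ^+ (n - i.+1).+1).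
have hd i : (i < n)%N -> d i.+1 <= h i * d i + f i.
  move=> ni; rewrite /d /X /Y /=.
  apply: le_trans (ln_step_contract _ _ _ _) _.
  - exact: pos tx (ltnW ni).
  - exact: pos ty (ltnW ni).
  - exact: lt_le_trans (fac0 _) (fac _ _ tx ni).
  - exact: lt_le_trans (fac0 _) (fac _ _ ty ni).
  rewrite lerD2l.
  apply: le_trans (ln_dist_le (fac0 _) (fac _ _ tx ni) (fac _ _ ty ni)) _.
  rewrite /f ler_wpM2r ?invr_ge0 ?(ltW (fac0 _))//.
  apply: le_trans (pinch_lipschitz _ _) _.
  by rewrite le_eqVlt; apply/orP; left; apply/eqP; congr (4 * `|_|); ring.
have h0 i : 0 <= h i by rewrite /h; case: ifP => // _; exact: ltW eta_gt0.
have d0 : d 0%N = 0 by rewrite /d /= subrr normr0.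
have := affine_recursion_le d0 h0 hd; rewrite /d => H.
apply: le_trans H _.
pose L := 4 * `|x - y| / (q * sg * (sg / 2) ^+ m).
apply: (@le_trans _ _ (\sum_(0 <= j < n) L * (1 / 2) ^+ (n - j.+1))).
  rewrite big_nat_cond [leRHS]big_nat_cond; apply: ler_sum => j /andP[/andP[_ jn] _].
  have f0 : 0 <= f j by apply: divr_ge0; [rewrite mulr_ge0 | exact: ltW].
  apply: le_trans (ler_wpM2r f0 (prod_contraction_le q0 tx ty hm jn)) _.
  rewrite /f /L le_eqVlt; apply/orP; left; apply/eqP.
  set k := (n - j.+1)%N; rewrite exprS !expr_div_n expr1n.
  have p1 : sg ^+ k != 0 by rewrite gt_eqF// exprn_gt0.
  have p2 : sg ^+ m != 0 by rewrite gt_eqF// exprn_gt0.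
  have p3 : 2 ^+ k != 0 :> R by rewrite gt_eqF// exprn_gt0.
  have p4 : 2 ^+ m != 0 :> R by rewrite gt_eqF// exprn_gt0.
  by field; rewrite p1 p2 p3 p4 !gt_eqF.
rewrite -mulr_sumr.
have L0 : 0 <= L.
  by rewrite /L !mulr_ge0 ?invr_ge0 ?mulr_ge0 ?exprn_ge0 ?(ltW z0) ?(ltW q0) ?(ltW s0).
apply: le_trans (ler_wpM2l L0 (sum_half_le n)) _.
rewrite /L /tame_lipschitz_const le_eqVlt; apply/orP; left; apply/eqP; ring.
Qed.

Lemma upper_limit_tame_ge q x : 0 < q -> tame q x ->
  q * (sg / 2) <= upper_limit kappa rho x.
Proof. by move=> q0 tx; apply: upper_limit_ge kappa_gt0 _ _ _ => n; exact: upper_line_tame_ge. Qed.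

Lemma upper_limit_lipschitz q x y m : 0 < q -> tame q x -> tame q y ->
  2 / (q ^+ 2 * sg) <= (eta^-1) ^+ m ->
  `|upper_limit kappa rho x - upper_limit kappa rho y| <=
  tame_lipschitz_const q m * `|x - y|.
Proof.
move=> q0 tx ty hm; have [s0 s1] : 0 < sg /\ sg <= 1 by apply/andP.
have half u v : tame q u -> tame q v ->
    upper_limit kappa rho u <= upper_limit kappa rho v + tame_lipschitz_const q m * `|u - v|.
  move=> tu tv; rewrite -lerBlDr; apply: (upper_limit_ge kappa_gt0) => n.
  rewrite lerBlDr (le_trans (upper_limit_le rho kappa_gt0 n u))//.
  rewrite -lerBlDl.
  have := ln_upper_line_lipschitz n q0 tu tv hm.
  have := upper_line_le1 rho kappa_gt0 n u.
  have v0 : 0 < q * (sg / 2) by rewrite mulr_gt0//; lra.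
  have := lt_le_trans v0 (upper_line_tame_ge n q0 tu).
  have := lt_le_trans v0 (upper_line_tame_ge n q0 tv).
  set a := upper_line _ _ _ u; set b := upper_line _ _ _ v => b0 a0 a1.
  move=> H; case: (leP b a) => [ba|/ltW ab]; last first.
    by apply: (le_trans _ (le_trans (normr_ge0 _) H)); rewrite subr_le0.
  apply: (le_trans _ (le_trans (ler_norm _) H)).
  have : ln b - ln a <= (b - a) / a.
    rewrite -ln_div ?posrE//; have -> : b / a = 1 + (b - a) / a by field; rewrite gt_eqF.
    apply: le_ln1Dx; rewrite mulrBl divff ?gt_eqF//.
    by have : 0 < b / a; [rewrite divr_gt0 | lra].
  have : a - b <= (a - b) / a by rewrite ler_pdivlMr//; nra.
  by rewrite -[b - a]opprB mulNr; lra.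
rewrite ler_norml lerNl opprB.
have := half x y tx ty; have := half y x ty tx; rewrite (distrC y x); lra.
Qed.

End contraction.

(** * Tame points of a Diophantine rotation *)

Section diophantine_rotation.
Context {R : realType}.
Variables (c rho : R) (D : nat).
Hypothesis c_gt0 : 0 < c.
Hypothesis dio : forall n, (0 < n)%N -> c / n%:R ^+ D <= pinch (n%:R * rho).

Lemma dio_le1 : c <= 1.
Proof.
have := dio (isT : (0 < 1)%N); rewrite expr1n divr1 mul1r => /le_trans; apply.
exact: pinch_le1.
Qed.

(** The decay rate of products of the forcing along orbits avoiding the strips
    of radius comparable to [2 ^ - i]: the separation accounts for the square,
    and the closest approach to the pinched point for the factor [1 / 2]. *)
Definition tame_rate : R := (c / 2 / 4 ^+ D) ^+ 2 / 2.

Lemma tame_base01 : 0 < c / 2 <= 1.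
Proof. by have c0 := c_gt0; have c1 := dio_le1; apply/andP; split; lra. Qed.

Lemma orbit_prod_lower (u : nat -> R) k d : (forall i, 0 <= u i <= 1) ->
  (forall i j, (i < j)%N -> pinch ((j - i)%:R * rho) <= u i + u j) ->
  0 <= d <= 1 -> (forall i, (i < k)%N -> d <= u i) ->
  (c / 2 / 4 ^+ D) ^+ (2 * k) * d <= \prod_(i < k) u i.
Proof.
move=> u01 sep d01 du; apply: prod_lower => //; first exact: tame_base01.
move=> i j ij; have := le_trans (dio (_ : (0 < j - i)%N)) (sep _ _ ij).
rewrite subn_gt0 => /(_ ij); rewrite mulrAC => h.
have : u i <= Num.max (u i) (u j) by rewrite le_max lexx.
have : u j <= Num.max (u i) (u j) by rewrite le_max lexx orbT.
move: (Num.max _ _) h => X h; lra.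
Qed.

Lemma tame_rate01 : 0 < tame_rate <= 1.
Proof.
have b0 := sep_base_gt0 D tame_base01; have b1 := sep_base_le1 D tame_base01.
have b2 : (c / 2 / 4 ^+ D) ^+ 2 <= 1 by rewrite exprn_ile1// ltW.
have b3 : 0 < (c / 2 / 4 ^+ D) ^+ 2 by rewrite exprn_gt0.
by rewrite /tame_rate; apply/andP; split; lra.
Qed.

Lemma tame_of_pinch_ge e x : 0 < e <= 1 ->
  (forall i, e * (1 / 2) ^+ i.+1 <= pinch (x - i.+1%:R * rho)) ->
  tame rho tame_rate e x.
Proof.
move=> /andP[e0 e1] h k.
have -> : e * tame_rate ^+ k = (c / 2 / 4 ^+ D) ^+ (2 * k) * (e * (1 / 2) ^+ k).
  by rewrite exprM mulrCA -exprMn /tame_rate mul1r.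
have h1 : 0 <= (1 / 2 : R) ^+ k <= 1.
  by apply/andP; split; [apply: exprn_ge0 | apply: exprn_ile1]; lra.
apply: (@orbit_prod_lower (fun i => pinch (x - i.+1%:R * rho))).
- by move=> i; rewrite pinch_ge0 pinch_le1.
- move=> i j ij; have -> : (j - i)%:R * rho = (x - i.+1%:R * rho) - (x - j.+1%:R * rho).
    rewrite -subSS natrB; last exact: ltnW.
    by ring.
  exact: pinchB.
- by case/andP: h1 => h1 h2; rewrite mulr_ge0 ?mulr_ile1// ltW.
- move=> i ik; apply: le_trans (h i); rewrite ler_pM2l// ler_wiXn2l//; lra.
Qed.

End diophantine_rotation.

Section diophantine_exponent.
Context {R : realType}.

Lemma diophantine_pinch (c d rho : R) (D : nat) : 0 < c -> d <= D%:R ->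
  diophantine c d rho ->
  forall n, (0 < n)%N -> c / n%:R ^+ D <= pinch (n%:R * rho).
Proof.
move=> c0 dD dio n n0; apply: le_trans (dist_int_le_pinch _).
apply: le_trans (dio n n0); rewrite ler_pM2l//.
rewrite -powR_mulrn// -powRN ler_powR ?ler1n//; lra.
Qed.

End diophantine_exponent.

(** * The upper bounding graph as a limit *)

Section upper_graph.
Context {R : realType}.
Variables (kappa rho : R).
Hypothesis kappa_gt0 : 0 < kappa.

Let F := pinched_map kappa rho.

Lemma circle_of_reprE (x : R) : exists k : int, circle_repr (circle_of x) = x + k%:~R.
Proof. by exists (- Num.floor x); rewrite rmorphN. Qed.

Lemma circle_of_repr_int (t : circle R) (k : int) : circle_of (circle_repr t + k%:~R) = t.
Proof.
apply: val_inj => /=; have /andP[t0 t1] := circle_reprP t.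
have -> : Num.floor (circle_repr t + k%:~R) = k.
  by apply: floor_def; rewrite lerDr t0 rmorphD /= addrC ltrD2l.
by rewrite addrK.
Qed.

Lemma sin_repr (t : circle R) : sin (pi * circle_repr t) = pinch (circle_repr t).
Proof.
have /andP[t0 t1] := circle_reprP t; have pi0 := pi_ge0 R.
rewrite /pinch ger0_norm// sin_ge0_pi// mulr_ge0//= ler_piMr// ltW//.
Qed.

Lemma pinched_map_upper_limit (t : circle R) :
  F (t, upper_limit kappa rho (circle_repr t)) =
  (circle_of (circle_repr t + rho),
   upper_limit kappa rho (circle_repr (circle_of (circle_repr t + rho)))).
Proof.
rewrite /F /pinched_map /=; congr pair.
rewrite -[_ - _]/(circle_repr (circle_of (circle_repr t + rho))).
have [k ->] := circle_of_reprE (circle_repr t + rho).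
by rewrite upper_limit_int upper_limit_invariant// sin_repr.
Qed.

Lemma iter_pinched_map_bounds n (p : circle R * R) : 0 <= p.2 <= 1 ->
  0 <= (iter n F p).2 <= upper_line kappa rho n (circle_repr (iter n F p).1).
Proof.
move=> p01; elim: n => [//|n /andP[y0 yl]].
rewrite iterS; set u := iter n F p in y0 yl *.
rewrite /F /pinched_map [X in _ <= X <= _]/= sin_repr.
rewrite [_.1]/=; have [k ->] := circle_of_reprE (circle_repr u.1 + rho).
rewrite upper_line_int upper_lineS addrK.
rewrite mulr_ge0 ?pinch_ge0 ?tanh_ge0 ?mulr_ge0 ?(ltW kappa_gt0)//=.
by rewrite ler_wpM2r ?pinch_ge0// tanh_le// ler_pM2l.
Qed.

(** The preimage of a point of the graph of [upper_limit] is again taken on that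
    graph. *)
Lemma upper_limit_attractor (t : circle R) :
  global_attractor kappa rho (t, upper_limit kappa rho (circle_repr t)).
Proof.
move=> n _; elim: n t => [|n IH] t.
  exists (t, upper_limit kappa rho (circle_repr t)) => //.
  by split => //=; rewrite in_itv/= upper_limit_ge0// upper_limit_le1.
pose t' := circle_of (circle_repr t - rho).
have [p pX pE] := IH t'; exists p => //.
have tE : circle_of (circle_repr t' + rho) = t.
  have [k ->] := circle_of_reprE (circle_repr t - rho).
  by rewrite addrAC subrK circle_of_repr_int.
by rewrite iterS -/F pE pinched_map_upper_limit tE.
Qed.

Lemma upper_bounding_graphE (t : circle R) :
  upper_bounding_graph kappa rho t = upper_limit kappa rho (circle_repr t).
Proof.
rewrite /upper_bounding_graph; set S := [set x | _].
have Su : ubound S (upper_limit kappa rho (circle_repr t)).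
  move=> x [_ ax]; apply: (upper_limit_ge kappa_gt0) => n.
  have [p [_ /=]] := ax n I; rewrite in_itv/= => p01 pE.
  by have /andP[_] := iter_pinched_map_bounds n p01; rewrite /F pE.
have Sm : S (upper_limit kappa rho (circle_repr t)).
  split; last exact: upper_limit_attractor.
  by rewrite /= in_itv/= upper_limit_ge0// upper_limit_le1.
apply/eqP; rewrite eq_le; apply/andP; split.
  by apply: ge_sup => //; exists (upper_limit kappa rho (circle_repr t)).
by apply: ub_le_sup => //; exists (upper_limit kappa rho (circle_repr t)).
Qed.

End upper_graph.

(** * Hausdorff measure and content *)

Section hausdorff_generalities.
Context {R : realType} {T : pseudoMetricType R}.
Implicit Types (A : set T) (s e : R).
Local Open Scope ereal_scope.

Lemma diam_ge0 A : 0 <= diam A.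
Proof. by rewrite /diam le_max lexx. Qed.

Lemma edist_le_diam A x y : A x -> A y -> edist (x, y) <= diam A.
Proof.
move=> Ax Ay; rewrite /diam le_max; apply/orP; right.
by apply: ereal_sup_ubound; exists (x, y).
Qed.

Lemma diam_le A (a : \bar R) : 0 <= a ->
  (forall x y, A x -> A y -> edist (x, y) <= a) -> diam A <= a.
Proof.
move=> a0 h; rewrite /diam ge_max a0 /=.
by apply: ge_ereal_sup => _ [[x y] [/= Ax Ay] <-]; exact: h.
Qed.

Lemma diam_set0 : diam (set0 : set T) = 0.
Proof.
by apply/eqP; rewrite eq_le diam_ge0 andbT; apply: diam_le.
Qed.

Lemma hausdorff_premeasure_le s e e' A : (e <= e')%R ->
  hausdorff_premeasure s e' A <= hausdorff_premeasure s e A.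
Proof.
move=> ee'; apply: ereal_inf_le_tmp => h [D [C [AC Ce ->]]].
by exists D, C; split => // i Di; rewrite (le_trans (Ce i Di))// lee_fin.
Qed.

Lemma hausdorff_measureE s A : hausdorff_measure s A =
  ereal_sup [set hausdorff_premeasure s e A | e in `]0%R, +oo[].
Proof.
apply/cvg_lim => //; apply: nonincreasing_at_right_cvge => //.
by move=> x y _ _ xy; exact: hausdorff_premeasure_le.
Qed.

Lemma hausdorff_premeasure_le_measure s e A : (0 < e)%R ->
  hausdorff_premeasure s e A <= hausdorff_measure s A.
Proof.
move=> e0; rewrite hausdorff_measureE; apply: ereal_sup_ubound.
by exists e => //=; rewrite in_itv/= e0.
Qed.

(** [covered s A v] bounds by [v] the [s]-dimensional Hausdorff content of [A]:
    no constraint is put on the diameters of the cover. *)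
Definition covered s A (v : \bar R) := exists C : nat -> set T,
  A `<=` \bigcup_i C i /\ \esum_(i in setT) (diam (C i) `^ s) <= v.

Lemma covered_sub s A B v : A `<=` B -> covered s B v -> covered s A v.
Proof. by move=> AB [C [BC Cv]]; exists C; split => //; exact: subset_trans BC. Qed.

Lemma covered_le s A v v' : v <= v' -> covered s A v -> covered s A v'.
Proof. by move=> vv' [C [AC Cv]]; exists C; split => //; exact: le_trans vv'. Qed.

Lemma covered_bigcup s (A : nat -> set T) (v : nat -> \bar R) :
  (forall i, covered s (A i) (v i)) ->
  covered s (\bigcup_i A i) (\esum_(i in setT) v i).
Proof.
move=> /choice[C hC].
have /card_esym/ppcard_eqP[f] := card_nat2.
exists (fun n => C (f n).1 (f n).2); split.
  move=> x [i _ Aix]; have [j _ Cx] := (hC i).1 x Aix.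
  exists (f^-1%FUN (i, j)) => //=.
  by rewrite invK ?inE.
rewrite -(reindex_esum setT setT f (fun k => diam (C k.1 k.2) `^ s)); last exact: bij.
apply: (@le_trans _ _ (\esum_(i in setT) \esum_(j in setT) (diam (C i j) `^ s))); last first.
  by apply: le_esum => i _; exact: (hC i).2.
rewrite esum_esum; last by move=> i j _ _; exact: poweR_ge0.
by rewrite (_ : setT `*`` _ = setT)//; apply/seteqP; split.
Qed.

Lemma covered_finite s N (A : nat -> set T) (a : R) : (0 < s)%R -> (0 <= a)%R ->
  (forall k, (k < N)%N -> diam (A k) `^ s <= a%:E) ->
  covered s (\bigcup_(k < N) A k) (N%:R * a)%:E.
Proof.
move=> s0 a0 hA; exists (fun k => if k \in `I_N then A k else set0); split.
  by move=> x [k kN Akx]; exists k => //; rewrite mem_set.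
rewrite (eq_esum (b := fun k => if k \in `I_N then diam (A k) `^ s else 0)); last first.
  by move=> k _; case: ifP => //; rewrite diam_set0 poweR0r ?gt_eqF.
rewrite -esum_mkcond esum_fset//; last by move=> i _; exact: poweR_ge0.
rewrite -fsbig_ord.
apply: (@le_trans _ _ (\sum_(k < N) a%:E)); first by apply: lee_sum => k _; exact: hA.
by rewrite sumEFin lee_fin sumr_const card_ord mulr_natl.
Qed.

Lemma hausdorff_measure_null s A : (0 < s)%R ->
  (forall v : R, (0 < v)%R -> covered s A v%:E) -> hausdorff_measure s A <= 0.
Proof.
move=> s0 hA; rewrite hausdorff_measureE; apply: ge_ereal_sup => _ [e /= + <-].
rewrite in_itv/= andbT => e0; apply/lee_addgt0Pr => v v0; rewrite add0e.
pose w := Num.min v (e `^ s)%R.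
have w0 : (0 < w)%R by rewrite /w lt_min v0 powR_gt0.
have [C [AC Cw]] := hA w w0.
apply: (@le_trans _ _ (\esum_(i in setT) (diam (C i) `^ s))).
  apply: ereal_inf_lbound; exists setT, C; split => // i _.
  rewrite leNgt; apply/negP => ei.
  have : diam (C i) `^ s <= w%:E.
    apply: le_trans Cw; apply: esum_ge; exists [set i].
      by split => //; exact: finite_set1.
    by rewrite fsbig_set1.
  apply/negP; rewrite -ltNge; apply: (@le_lt_trans _ _ (e `^ s)%:E).
    by rewrite lee_fin ge_min lexx orbT.
  case: (diam (C i)) ei => [r| |//]; last first.
    by move=> _; rewrite poweRyr ?gt_eqF// ltry.
  rewrite !lte_fin => er.
  by rewrite gt0_ltr_powR// ?nnegrE// ltW// (lt_trans e0).
by rewrite (le_trans Cw)// lee_fin ge_min lexx.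
Qed.

End hausdorff_generalities.

Section product_distance.
Context {R : realType}.
Implicit Types p q : circle R * R.

Lemma edist_le (p q : circle R * R) (a : R) :
  circle_dist p.1 q.1 <= a -> `|p.2 - q.2| <= a -> (edist (p, q) <= a%:E)%E.
Proof.
move=> h1 h2; apply/lee_addgt0Pr => e e0.
have a0 : 0 <= a by exact: le_trans h2.
rewrite -EFinD; apply: edist_fin; first by rewrite ltr_wpDl.
split => /=.
  by rewrite ballEmdist /=; apply: le_lt_trans h1 _; rewrite ltrDl.
by rewrite -ball_normE /= (le_lt_trans h2)// ltrDl.
Qed.

Lemma edist_lt_fst (p q : circle R * R) (a : R) :
  (edist (p, q) < a%:E)%E -> circle_dist p.1 q.1 < a.
Proof. by move=> /edist_lt_ball[+ _] /=; rewrite ballEmdist. Qed.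

Lemma edist_ge_snd (p q : circle R * R) : (`|p.2 - q.2|%:E <= edist (p, q))%E.
Proof.
rewrite leNgt; apply/negP => /edist_lt_ball[_] /=.
by rewrite -ball_normE /= ltxx.
Qed.

End product_distance.

(** * The graph is null in dimension greater than one *)

Section null_sets.
Context {R : realType}.
Implicit Types (s v : R).

Lemma covered_null_bigcup {T : pseudoMetricType R} s (A : nat -> set T) :
  (forall i v, 0 < v -> covered s (A i) v%:E) ->
  forall v, 0 < v -> covered s (\bigcup_i A i) v%:E.
Proof.
move=> h v v0; have v2 i : 0 < v / (2 ^ i.+1)%:R.
  by rewrite divr_gt0// ltr0n expn_gt0.
apply: covered_le (covered_bigcup (fun i => h i _ (v2 i))).
rewrite -nneseries_esumT; last by move=> i; rewrite lee_fin ltW.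
exact: (epsilon_trick0 xpredT (ltW v0)).
Qed.

Lemma diam_powR_le {T : pseudoMetricType R} (A : set T) (a s : R) : 0 <= a -> 0 < s ->
  (forall x y, A x -> A y -> (edist (x, y) <= a%:E)%E) ->
  (diam A `^ s <= (a `^ s)%:E)%E.
Proof.
move=> a0 s0 h; rewrite -poweR_EFin.
have dA : (diam A <= a%:E)%E by apply: diam_le => //; rewrite lee_fin.
apply: gt0_ler_poweR => //; first exact: ltW.
- by rewrite in_itv/= diam_ge0 leey.
- by rewrite in_itv/= lee_fin a0 leey.
Qed.

(** A Lipschitz graph is covered by [N] pieces of diameter at most [L / N], and
    [N * (L / N) ^ s] tends to [0]. *)
Lemma lipschitz_graph_covered (A : set (circle R * R)) (L s : R) : 1 < s -> 1 <= L ->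
  (forall p q, A p -> A q ->
    `|p.2 - q.2| <= L * `|circle_repr p.1 - circle_repr q.1|) ->
  forall v, 0 < v -> covered s A v%:E.
Proof.
move=> s1 L1 hA v v0.
have s0 : 0 < s by lra.
have L0 : 0 <= L by lra.
have Ls0 : 0 < L `^ s by rewrite powR_gt0//; lra.
have Lp : 0 < L by lra.
(* [M] solves [M * (L / M) ^ s = v]. *)
pose M := (L `^ s / v) `^ (1 / (s - 1)).
pose N := (Num.truncn M).+1.
have MN : M <= N%:R by rewrite ltW// truncnS_gt.
have N0 : 0 < N%:R :> R by rewrite ltr0n.
pose a := L / N%:R.
have a0 : 0 <= a by rewrite divr_ge0// ltW.
pose P k := [set p | A p /\ k%:R / N%:R <= circle_repr p.1 < k.+1%:R / N%:R].
have PA : A `<=` \bigcup_(k < N) P k.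
  move=> p Ap; have /andP[p0 p1] := circle_reprP p.1.
  have Np0 : 0 <= N%:R * circle_repr p.1 by rewrite mulr_ge0// ltW.
  exists (Num.truncn (N%:R * circle_repr p.1)).
    by rewrite /= truncn_lt_nat// -[ltRHS]mulr1 ltr_pM2l.
  split => //; rewrite ler_pdivrMr// ltr_pdivlMr// ![circle_repr _ * _]mulrC.
  exact: truncn_itv.
have Pd k : (k < N)%N -> (diam (P k) `^ s <= (a `^ s)%:E)%E.
  move=> kN; apply: diam_powR_le => // p q [Ap /andP[p1 p2]] [Aq /andP[q1 q2]].
  have d1 : `|circle_repr p.1 - circle_repr q.1| <= 1 / N%:R.
    have NE : k.+1%:R / N%:R = k%:R / N%:R + 1 / N%:R :> R by rewrite -mulrDl natr1.
    by rewrite ler_norml; lra.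
  have d2 : L * `|circle_repr p.1 - circle_repr q.1| <= a.
    by rewrite /a; have := ler_wpM2l L0 d1; rewrite mulrA mulr1.
  apply: edist_le; last exact: le_trans (hA p q Ap Aq) d2.
  have := dist_int_le (circle_repr p.1 - circle_repr q.1) 0; rewrite subr0 => h.
  apply: le_trans h (le_trans _ d2).
  by rewrite ler_peMl.
apply: covered_sub PA _.
apply: covered_le (covered_finite s0 (powR_ge0 _ _) Pd).
rewrite lee_fin /a powRM ?invr_ge0 ?(ltW N0)//.
rewrite -powR_inv1 ?(ltW N0)// -powRrM mulN1r powRN.
rewrite mulrCA -ler_pdivlMl//.
have -> : (L `^ s)^-1 * v = (L `^ s / v)^-1 by rewrite invf_div mulrC.
have -> : N%:R / N%:R `^ s = (N%:R `^ (s - 1))^-1 :> R.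
  rewrite powRB ?gt_eqF ?implybT// powRr1 ?(ltW N0)// invf_div//.
rewrite lef_pV2 ?posrE ?divr_gt0 ?powR_gt0//.
have -> : L `^ s / v = M `^ (s - 1).
  by rewrite /M -powRrM mul1r mulVf ?powRr1 ?gt_eqF ?divr_ge0 ?(ltW Ls0) ?(ltW v0) ?subr_gt0.
by rewrite ge0_ler_powR ?nnegrE ?powR_ge0// ?subr_ge0 ltW.
Qed.

End null_sets.

Section pinched_strips.
Context {R : realType}.
Implicit Types (s v : R).

(** The part of height at most [1] of the vertical strip of radius about [r]
    around [y]. *)
Definition strip (y r : R) : set (circle R * R) :=
  [set p | pinch (circle_repr p.1 - y) < r /\ 0 <= p.2 <= 1].

(** Squares of side about [r = 2 ^ - n]; the number [2 ^ (n + 1)] of squares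
    leaves room for the height [1]. *)
Lemma strip_covered s y n : 0 < s ->
  covered s (strip y ((1 / 2) ^+ n)) (2 * 2 `^ s * (2 * (1 / 2) `^ s) ^+ n)%:E.
Proof.
move=> s0; set r : R := (1 / 2) ^+ n.
have r0 : 0 < r by rewrite exprn_gt0//; lra.
have r2 : 2 ^+ n * r = 1 by rewrite /r -exprMn mul1r mulfV// expr1n.
pose P k := [set p | strip y r p /\ k%:R * r <= p.2 < k.+1%:R * r].
have SP : strip y r `<=` \bigcup_(k < 2 ^ n.+1) P k.
  move=> p [h /andP[p0 p1]].
  have q0 : 0 <= 2 ^+ n * p.2 by rewrite mulr_ge0// exprn_ge0.
  exists (Num.truncn (2 ^+ n * p.2)) => /=.
    rewrite truncn_lt_nat// natrX exprS.
    have e1 : 0 < 2 ^+ n :> R by rewrite exprn_gt0.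
    have : 2 ^+ n * p.2 <= 2 ^+ n by rewrite ler_piMr// ltW.
    lra.
  split; first by split => //; rewrite p0.
  have /andP[t1 t2] := truncn_itv q0.
  set k := Num.truncn _ in t1 t2 *.
  have pE : p.2 = 2 ^+ n * p.2 * r by rewrite mulrAC r2 mul1r.
  by rewrite pE ler_pM2r// ltr_pM2r// t1.
have Pd k : (k < 2 ^ n.+1)%N -> (diam (P k) `^ s <= ((2 * r) `^ s)%:E)%E.
  move=> kN; apply: diam_powR_le => //; first by lra.
  move=> p q [[hp _] /andP[p1 p2]] [[hq _] /andP[q1 q2]].
  apply: edist_le.
    apply: le_trans (dist_int_le_pinch _) _.
    have -> : circle_repr p.1 - circle_repr q.1 =
      (circle_repr p.1 - y) - (circle_repr q.1 - y) by ring.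
    apply: le_trans (pinchB _ _) _; lra.
  have kE : k.+1%:R * r = k%:R * r + r by rewrite -natr1; ring.
  by rewrite ler_norml; apply/andP; split; lra.
apply: covered_sub SP _.
apply: covered_le (covered_finite s0 (powR_ge0 _ _) Pd).
rewrite lee_fin le_eqVlt; apply/orP; left; apply/eqP.
rewrite powRM ?(ltW r0)// /r -[(1 / 2) ^+ n]powR_mulrn; last by lra.
by rewrite powRAC powR_mulrn ?powR_ge0// natrX exprS exprMn; ring.
Qed.

Lemma strip_ratio s : 1 < s -> 0 <= 2 * (1 / 2) `^ s < 1.
Proof.
move=> s1; rewrite mulr_ge0 ?powR_ge0//=.
rewrite mul1r -powR_inv1// -powRrM mulN1r powRN ltr_pdivrMr ?powR_gt0// mul1r.
rewrite -[X in X < _]powRr1// /powR gt_eqF// ltr_expR ltr_pM2r// ln_gt0//; lra.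
Qed.

(** At the scale [j], the squares covering the strips contribute at most a
    multiple of [\sum_i (2 ^ (1 - s)) ^ (j + i)]. *)
Lemma limsup_strips_covered s (y : nat -> R) v : 1 < s -> 0 < v ->
  covered s (\bigcap_j \bigcup_i strip (y i) ((1 / 2) ^+ (j + i))) v%:E.
Proof.
move=> s1 v0; have s0 : 0 < s by lra.
have /andP[q0 q1] := strip_ratio s1; set q := 2 * _ in q0 q1.
pose a := 2 * 2 `^ s : R.
have a0 : 0 < a by rewrite mulr_gt0// powR_gt0.
have [||j hj] := @expr_small _ q (v * (1 - q) / a).
- by rewrite q0.
- by rewrite divr_gt0// mulr_gt0// subr_gt0.
apply: (@covered_sub _ _ _ _ (\bigcup_i strip (y i) ((1 / 2) ^+ (j + i)))).
  by move=> p /(_ j I).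
apply: covered_le (covered_bigcup (fun i => strip_covered (y i) (j + i) s0)).
rewrite (eq_esum (b := fun i => (a * q ^+ j * q ^+ i)%:E)); last first.
  by move=> i _; rewrite -/q -/a exprD mulrA.
apply: le_trans (esum_geometric_le _ _) _.
- by rewrite mulr_ge0 ?exprn_ge0// ltW.
- by rewrite q0.
rewrite lee_fin ler_pdivrMr ?subr_gt0// mulrC -ler_pdivlMr//; exact: ltW.
Qed.

End pinched_strips.

Section upper_graph_null.
Context {R : realType}.
Variables (c rho kappa : R) (D : nat).
Hypothesis c_gt0 : 0 < c.
Hypothesis dio : forall n, (0 < n)%N -> c / n%:R ^+ D <= pinch (n%:R * rho).

Let sg := tame_rate c D.
Let sg01 : 0 < sg <= 1. Proof. exact: (tame_rate01 c_gt0 dio). Qed.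

Hypothesis kappa_large : (4 / sg ^+ 2) ^+ 4 * (1 + 16 / sg ^+ 2) <= kappa.

Lemma contraction_exponent (q : R) : 0 < q ->
  exists m, 2 / (q ^+ 2 * sg) <= ((sg ^+ 2 / 4)^-1) ^+ m.
Proof.
move=> q0; have e0 := eta_gt0 sg01; have e1 : sg ^+ 2 / 4 < 1.
  rewrite ltr_pdivrMr// mul1r (@le_lt_trans _ _ 1) ?exprn_ile1//; last by lra.
    by case/andP: sg01 => /ltW.
  by case/andP: sg01.
have s0 : 0 < sg by case/andP: sg01.
have b0 : 0 < q ^+ 2 * sg / 2 by rewrite divr_gt0// mulr_gt0// exprn_gt0.
have q01 : 0 <= sg ^+ 2 / 4 < 1 by rewrite (ltW e0) e1.
have [m hm] := expr_small q01 b0.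
exists m; rewrite exprVn -invf_div lef_pV2 ?posrE ?exprn_gt0//; exact: ltW.
Qed.

(** The graph over the tame points of constant [2 ^ - j] is Lipschitz; points
    that are not tame for any [j] lie in a strip at every scale. *)
Lemma upper_graph_measure_gt1 s : 1 < s ->
  (hausdorff_measure s (upper_graph_set kappa rho) <= 0)%E.
Proof.
move=> s1; have s0 : 0 < s by lra.
apply: hausdorff_measure_null => // v v0.
have k0 := kappa_gt0 sg01 kappa_large.
pose G := upper_graph_set kappa rho.
have Gval p : G p -> p.2 = upper_limit kappa rho (circle_repr p.1).
  by move=> [t _ <-] /=; rewrite upper_bounding_graphE.
pose e j : R := (1 / 2) ^+ j.
have e0 j : 0 < e j <= 1.
  by rewrite exprn_gt0 ?exprn_ile1//; lra.
pose A n := if n is j.+1 then [set p | G p /\ tame rho sg (e j) (circle_repr p.1)]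
  else \bigcap_j \bigcup_i strip (i.+1%:R * rho) ((1 / 2) ^+ (j + i)).
apply: (@covered_sub _ _ _ _ (\bigcup_n A n)); last first.
  apply: covered_null_bigcup => // -[|j] w w0; first exact: limsup_strips_covered.
  have /andP[ej0 ej1] := e0 j.
  have [m hm] := contraction_exponent ej0.
  pose L := Num.max 1 (tame_lipschitz_const sg (e j) m).
  apply: (@lipschitz_graph_covered _ _ L) => //; first by rewrite /L le_max lexx.
  move=> p q [Gp tp] [Gq tq]; rewrite (Gval p Gp) (Gval q Gq).
  apply: le_trans (upper_limit_lipschitz sg01 kappa_large ej0 tp tq hm) _.
  by rewrite ler_wpM2r// /L le_max lexx orbT.
move=> p Gp.
have [[j tj]|nt] := pselect (exists j, tame rho sg (e j) (circle_repr p.1)).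
  by exists j.+1.
exists 0%N => // j _.
have nj : ~ tame rho sg (e j.+1) (circle_repr p.1) by move=> tj; apply: nt; exists j.+1.
have : ~ (forall i, e j.+1 * (1 / 2) ^+ i.+1 <= pinch (circle_repr p.1 - i.+1%:R * rho)).
  by move=> h; apply: nj; exact: tame_of_pinch_ge.
move=> /existsNP[i /negP]; rewrite -ltNge => hi; exists i => //; split.
  apply: lt_le_trans hi _.
  have h1 : 0 <= 1 / 2 :> R by lra.
  have h2 : 1 / 2 <= 1 :> R by lra.
  by rewrite /e -exprD; apply: ler_wiXn2l => //; lia.
by rewrite (Gval p Gp) upper_limit_ge0// upper_limit_le1.
Qed.

End upper_graph_null.

(** * The graph has infinite length *)

Section interval_covers.
Context {R : realType}.

Local Open Scope ereal_scope.

(** A set of diameter at most [r] lies in an interval of length [2 r] around any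
    of its points; the factor [2] is harmless. *)
Lemma small_pieces_measure (D : set nat) (S : nat -> set R) (d : nat -> \bar R) :
  (forall i, 0 <= d i) ->
  (forall i x y, D i -> S i x -> S i y -> (`|x - y|%:E <= d i)) ->
  exists U : set R, [/\ measurable U, \bigcup_(i in D) S i `<=` U &
    lebesgue_measure U <= 2%:E * \esum_(i in D) d i].
Proof.
move=> d0 hS.
have /choice[J hJ] i : exists J : set R, [/\ measurable J, D i -> S i `<=` J &
    lebesgue_measure J <= 2%:E * d i].
  have [[x [Di Sx]]|nS] := pselect (exists x, D i /\ S i x); last first.
    exists set0; split => //; last by rewrite measure0 mule_ge0.
    by move=> Di x Sx; apply: nS; exists x.
  case E : (d i) => [r| |]; last by have := d0 i; rewrite E.
    exists `[(x - r)%R, (x + r)%R]%classic; split => //.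
      move=> _ y Sy; have := hS i x y Di Sx Sy; rewrite E lee_fin /= in_itv/=.
      by rewrite ler_norml; lra.
    have r0 : (0 <= r)%R by have := d0 i; rewrite E lee_fin.
    rewrite lebesgue_measure_itv/=; case: ifP => _; last by rewrite mule_ge0// lee_fin.
    by rewrite -EFinB -EFinM lee_fin; lra.
  by exists setT; split => //; rewrite gt0_muley ?leey.
exists (\bigcup_(i in D) J i); split.
- by apply: bigcup_measurable => i _; case: (hJ i).
- by move=> x [i Di Sx]; exists i => //; case: (hJ i) => _ h _; exact: h.
rewrite bigcup_mkcond.
apply: (@le_trans _ _ (\esum_(i in setT) lebesgue_measure (if i \in D then J i else set0))).
  rewrite -nneseries_esumT; last by move=> i; exact: measure_ge0.
  apply: measure_sigma_subadditive => //.
    by move=> i; case: ifP => // _; case: (hJ i).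
  by apply: bigcup_measurable => i _; case: ifP => // _; case: (hJ i).
rewrite (eq_esum (b := fun i => if i \in D then lebesgue_measure (J i) else 0)); last first.
  by move=> i _; case: ifP => // _; rewrite measure0.
rewrite -esum_mkcond.
apply: (@le_trans _ _ (\esum_(i in D) (d i + d i))).
  apply: le_esum => i _; case: (hJ i) => _ _.
  by rewrite (_ : 2%:E = 1 + 1)// ge0_muleDl// mul1e.
rewrite esumD// (_ : 2%:E = 1 + 1)// ge0_muleDl ?mul1e// esum_ge0//.
Qed.

Lemma interval_cover_length (h : R) (D D' : set nat) (S S' : nat -> set R)
    (d d' : nat -> \bar R) :
  (0 <= h)%R -> (forall i, 0 <= d i) -> (forall i, 0 <= d' i) ->
  (forall i x y, D i -> S i x -> S i y -> (`|x - y|%:E <= d i)) ->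
  (forall i x y, D' i -> S' i x -> S' i y -> (`|x - y|%:E <= d' i)) ->
  (forall y, (0 <= y <= h)%R ->
    (\bigcup_(i in D) S i) y \/ (\bigcup_(i in D') S' i) y) ->
  h%:E <= 2%:E * (\esum_(i in D) d i) + 2%:E * (\esum_(i in D') d' i).
Proof.
move=> h0 d0 d'0 hS hS' cov.
have [U [mU SU Ud]] := small_pieces_measure d0 hS.
have [U' [mU' SU' Ud']] := small_pieces_measure d'0 hS'.
have -> : h%:E = lebesgue_measure (`[0%R, h]%classic : set R).
  rewrite lebesgue_measure_itv/= lte_fin; case: ltP => [_|hh]; first by rewrite sube0.
  by congr _%:E; apply/eqP; rewrite eq_le h0 hh.
apply: (@le_trans _ _ (lebesgue_measure (U `|` U'))).
  apply: le_measure; rewrite ?inE//; first exact: measurableU.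
  by move=> y /=; rewrite in_itv/= => /cov[/SU|/SU']; [left|right].
apply: (@le_trans _ _ (lebesgue_measure U + lebesgue_measure U')).
  exact: measureU2.
exact: leeD.
Qed.

End interval_covers.

Section orbit_curves.
Context {R : realType}.
Variables (kappa rho : R).
Hypothesis kappa_gt0 : 0 < kappa.

Lemma fiber_orbit_upper_limit t n :
  fiber_orbit kappa rho t (upper_limit kappa rho t) n =
  upper_limit kappa rho (t + n%:R * rho).
Proof.
elim: n => [|n IH] /=; first by rewrite mul0r addr0.
rewrite IH -upper_limit_invariant//; congr upper_limit.
by rewrite -natr1; ring.
Qed.

(** The image of the fibre over the pinched point [0] is a single point, hence
    its further images stay at height [0]. *)
Lemma fiber_orbit_pinched z n : fiber_orbit kappa rho 0 z n.+1 = 0.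
Proof.
elim: n => [|n IH]; first by rewrite /= mul0r addr0 pinch0 mulr0.
by rewrite [fiber_orbit _ _ _ _ _]/= -[_ * pinch (0 + n%:R * rho)]/(fiber_orbit kappa rho 0 z n.+1) IH mulr0 tanh0 mul0r.
Qed.

Variables (psi : R -> R) (L : R).
Hypothesis L_ge1 : 1 <= L.
Hypothesis psi01 : forall t, 0 <= psi t <= 1.
Hypothesis psi_lip : forall t u, `|psi t - psi u| <= L * `|t - u|.

Lemma fiber_orbit_lipschitz n t u :
  `|fiber_orbit kappa rho t (psi t) n - fiber_orbit kappa rho u (psi u) n|
  <= (2 * kappa + 4) ^+ n * L * `|t - u|.
Proof.
have k0 := kappa_gt0; have L1 := L_ge1.
elim: n => [|n IH] /=; first by rewrite expr0 mul1r; exact: psi_lip.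
set y := fiber_orbit _ _ t _ _ in IH *; set z := fiber_orbit _ _ u _ _ in IH *.
have y0 : 0 <= y by apply: fiber_orbit_ge0 => //; case/andP: (psi01 t).
have z0 : 0 <= z by apply: fiber_orbit_ge0 => //; case/andP: (psi01 u).
set a := pinch _; set b := pinch _.
have -> : tanh (kappa * y) * a - tanh (kappa * z) * b =
  (tanh (kappa * y) - tanh (kappa * z)) * a + tanh (kappa * z) * (a - b) by ring.
set e := (2 * kappa + 4) ^+ n * L in IH.
have e1 : 1 <= e by rewrite /e mulr_ege1// exprn_ege1//; lra.
have d0 : 0 <= `|t - u| by [].
have h1 : `|(tanh (kappa * y) - tanh (kappa * z)) * a| <= 2 * kappa * (e * `|t - u|).
  rewrite normrM (ger0_norm (pinch_ge0 _)).
  apply: (@le_trans _ _ `|tanh (kappa * y) - tanh (kappa * z)|).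
    by rewrite ler_piMr// pinch_le1.
  apply: le_trans (tanh_lipschitz _ _) _; rewrite ?mulr_ge0 ?(ltW k0)//.
  by rewrite -mulrBr normrM (ger0_norm (ltW k0)) -mulrA ler_pM2l// ler_pM2l.
have h2 : `|tanh (kappa * z) * (a - b)| <= 4 * `|t - u|.
  have tz0 : 0 <= tanh (kappa * z) by rewrite tanh_ge0// mulr_ge0// ltW.
  rewrite normrM (ger0_norm tz0).
  apply: (@le_trans _ _ `|a - b|); first by rewrite ler_piMl// tanh_le1.
  apply: le_trans (pinch_lipschitz _ _) _.
  by rewrite le_eqVlt; apply/orP; left; apply/eqP; congr (4 * `|_|); ring.
apply: le_trans (ler_normD _ _) _; 
have -> : (2 * kappa + 4) ^+ n.+1 * L * `|t - u| =
  (2 * kappa + 4) * (e * `|t - u|) by rewrite /e exprS; ring.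
have h3 : `|t - u| <= e * `|t - u| by rewrite ler_peMl.
rewrite [leRHS]mulrDl; apply: lerD => //; apply: le_trans h2 _; lra.
Qed.

Lemma fiber_orbit_continuous n :
  continuous (fun t => fiber_orbit kappa rho t (psi t) n).
Proof.
move=> t; apply/cvgrPdist_le => e e0.
have k0 := kappa_gt0; have L1 := L_ge1.
set l := (2 * kappa + 4) ^+ n * L.
have l0 : 0 < l by rewrite /l mulr_gt0 ?exprn_gt0//; lra.
exists (e / l) => /=; first by rewrite divr_gt0.
move=> u /= tu; apply: le_trans (fiber_orbit_lipschitz n t u) _.
by rewrite -/l mulrC -ler_pdivlMr// ltW.
Qed.

End orbit_curves.

Section upper_graph_infinite.
Context {R : realType}.
Variables (c rho kappa : R) (D : nat).
Hypothesis c_gt0 : 0 < c.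
Hypothesis dio : forall n, (0 < n)%N -> c / n%:R ^+ D <= pinch (n%:R * rho).

Let sg := tame_rate c D.
Let sg01 : 0 < sg <= 1. Proof. exact: (tame_rate01 c_gt0 dio). Qed.

Hypothesis kappa_large : (4 / sg ^+ 2) ^+ 4 * (1 + 16 / sg ^+ 2) <= kappa.

Let kappa0 : 0 < kappa. Proof. exact: (kappa_gt0 sg01 kappa_large). Qed.

Let phi := upper_limit kappa rho.
Let G := upper_graph_set kappa rho.

(** The points avoiding, for all [i >= 1], the strip of radius about
    [e * 2 ^ - i] around the [i]-th iterate of the pinched point [0]. *)
Definition good_set (e : R) : set R :=
  [set t | forall i, e * (1 / 2) ^+ i.+1 <= pinch (t - i.+1%:R * rho)].

(** A radius for which [good_set] contains [0], by the separation of [0] from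
    its iterates. *)
Lemma strip_radius_exists : exists2 e : R, 0 < e <= 1 &
  forall i, e * (1 / 2) ^+ i.+1 <= c / (2 * i.+1%:R ^+ D).
Proof.
have [B B0 hB] := @poly_le_expn_bound R D.
have cB : 0 < c / (2 * B) by rewrite divr_gt0// mulr_gt0.
exists (Num.min 1 (c / (2 * B))).
  by rewrite lt_min ltr01 cB ge_min lexx.
move=> i; have i0 : 0 < i.+1%:R ^+ D :> R by rewrite exprn_gt0.
have t0 : 0 < 2 ^+ i.+1 :> R by rewrite exprn_gt0.
apply: (@le_trans _ _ (c / (2 * B) * (1 / 2) ^+ i.+1)).
  by rewrite ler_wpM2r ?exprn_ge0// ge_min lexx orbT.
rewrite expr_div_n expr1n mul1r !invfM !mulrA -[leLHS]mulrA ler_pM2l; last first.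
  by rewrite mulr_gt0.
rewrite -invfM lef_pV2 ?posrE ?mulr_gt0//; exact: hB.
Qed.

Lemma good_set0 e : (forall i, e * (1 / 2) ^+ i.+1 <= c / (2 * i.+1%:R ^+ D)) ->
  good_set e 0.
Proof.
move=> he i; rewrite sub0r pinchN; apply: le_trans (he i) _.
apply: le_trans (dio (ltn0Sn i)); rewrite ler_pM2l// lef_pV2 ?posrE ?mulr_gt0 ?exprn_gt0//.
by rewrite ler_peMl ?exprn_ge0//; lra.
Qed.

(** On the good set the upper bounding graph is Lipschitz and bounded away from
    [0], and it extends to the line with these properties. *)
Lemma good_extension e : 0 < e <= 1 -> good_set e 0 ->
  exists2 L : R, 1 <= L & exists psi : R -> R,
    [/\ forall t, good_set e t -> psi t = phi t,
        forall t u, `|psi t - psi u| <= L * `|t - u| &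
        forall t, e * (sg / 2) <= psi t <= 1].
Proof.
move=> e01 K0; have /andP[e0 e1] := e01.
have [m hm] := contraction_exponent c_gt0 dio e0.
have tK t : good_set e t -> tame rho sg e t by exact: tame_of_pinch_ge.
pose L := Num.max 1 (tame_lipschitz_const sg e m).
exists L; first by rewrite /L le_max lexx.
apply: lipschitz_extension; first by rewrite le_max ler01.
- by exists 0.
- by move=> t /tK tt; rewrite (upper_limit_tame_ge sg01 kappa_large)// upper_limit_le1.
- move=> t u /tK tt /tK tu.
  apply: le_trans (upper_limit_lipschitz sg01 kappa_large e0 tt tu hm) _.
  by rewrite ler_wpM2r// /L le_max lexx orbT.
Qed.

(** The height of the threshold: points at or above it are not low. *)
Let height : R := 16 / sg ^+ 2 / kappa.

Lemma height_gt0 : 0 < height.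
Proof.
have s0 : 0 < sg by case/andP: sg01.
by rewrite /height divr_gt0// divr_gt0// exprn_gt0.
Qed.

(** The orbit of [(t, z)] is high at least half of the time up to [N], provided
    the forcing along it stays above some [d], with [d z] not exponentially
    small. *)
Lemma high_times z d t N : 0 < z <= 1 -> 0 < d <= 1 ->
  (forall n, (n < N)%N -> d <= pinch (t + n%:R * rho)) ->
  1 / (d * z) <= 4 ^+ N ->
  (2 * low_count kappa rho sg t z 0 N <= N)%N.
Proof.
move=> /andP[z0 z1] /andP[d0 d1] hd dz.
have /andP[s0 s1] := sg01.
have z01 : 0 <= z <= 1 by rewrite ltW.
have := orbit_growth rho sg01 kappa_large t 0 N z01; rewrite add0n big_mkord.
move=> /le_trans => /(_ _ (fiber_orbit_le1 rho kappa0 t N z01)) /= h.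
have P1 : sg ^+ N * d <= \prod_(i < N) pinch (t + i%:R * rho).
  have : (c / 2 / 4 ^+ D) ^+ (2 * N) * d <= \prod_(i < N) pinch (t + i%:R * rho).
    apply: (orbit_prod_lower c_gt0 dio (u := fun i => pinch (t + i%:R * rho))) => //.
    - by move=> i; rewrite pinch_ge0 pinch_le1.
    - move=> i j ij.
      have -> : (j - i)%:R * rho = (t + j%:R * rho) - (t + i%:R * rho).
        by rewrite natrB ?(ltnW ij)//; ring.
      by rewrite [leRHS]addrC; exact: pinchB.
    - by rewrite (ltW d0).
  apply: le_trans; rewrite ler_pM2r// exprM.
  have b0 := sep_base_gt0 D (tame_base01 c_gt0 dio).
  have b2 : 0 <= (c / 2 / 4 ^+ D) ^+ 2 by rewrite exprn_ge0// ltW.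
  apply: lerXn2r; rewrite ?nnegrE ?(ltW s0)//.
  by rewrite /sg /tame_rate; lra.
have A0 : 0 < sg ^+ N * d * z by rewrite !mulr_gt0// exprn_gt0.
rewrite -(leq_pmul2l (isT : (0 < 2)%N)) mulnA.
apply: (pow_low_count sg01 kappa_large A0 (K := N)).
  apply: le_trans h; rewrite -[leRHS]mulrA; apply: ler_wpM2l.
    have g1 := gain_ge1 sg01 kappa_large.
    by rewrite mulr_ge0// exprn_ge0//; lra.
  by rewrite ler_pM2r.
have -> : 2 ^+ N / (sg ^+ N * d * z) = (2 / sg) ^+ N * (1 / (d * z)).
  by rewrite [(2 / sg) ^+ N]expr_div_n; field; rewrite !gt_eqF// exprn_gt0.
have e1 : 4 <= (sg ^+ 2 / 4)^-1.
  rewrite invf_div ler_pdivlMr ?exprn_gt0// ler_piMr//.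
  by rewrite exprn_ile1// ltW.
rewrite mul2n -addnn exprD; apply: ler_pM.
- by rewrite exprn_ge0// divr_ge0// ltW.
- by rewrite divr_ge0// mulr_ge0// ltW.
- apply: lerXn2r; rewrite ?nnegrE.
  + by rewrite divr_ge0// ltW.
  + by apply: le_trans e1.
  rewrite [(sg ^+ 2 / 4)^-1]invf_div ler_pdivlMr ?exprn_gt0// expr2 mulrA divfK ?gt_eqF//.
  by lra.
apply: le_trans dz _; apply: lerXn2r; rewrite ?nnegrE//.
by apply: le_trans e1.
Qed.

(** The indices of the sets [C i] meeting the part of the phase space over the
    arc [n rho + [0, tau]]. *)
Definition near_orbit (tau : R) (C : nat -> set (circle R * R)) (n : nat) : set nat :=
  [set i | exists2 p, C i p & exists2 t, 0 <= t <= tau & p.1 = circle_of (t + n%:R * rho)].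

(** The curve [t |-> fiber_orbit t (psi t) n] on [[0, tau]] starts at height [0]
    and ends at or above [height], so it takes all values in between. At good [t] it
    runs in the upper bounding graph, hence inside the cover. The other [t] lie
    in strips of index at least [A * N], because [0] is separated from its first
    [A * N] iterates by more than [tau] allows; the images of these strips have
    total length at most [height / 4]. *)
Lemma piece_length e psi L (N A n : nat) tau (I : set nat) (C : nat -> set (circle R * R)) :
  0 < e <= 1 -> (forall i, e * (1 / 2) ^+ i.+1 <= c / (2 * i.+1%:R ^+ D)) ->
  1 <= L -> (forall t, good_set e t -> psi t = phi t) ->
  (forall t u, `|psi t - psi u| <= L * `|t - u|) -> (forall t, 0 <= psi t <= 1) ->
  2 * (2 * kappa + 4) <= 2 ^+ A -> (0 < A * N)%N ->
  tau = c / (8 * (A * N)%:R ^+ D) ->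
  (0 < n < N)%N -> height <= fiber_orbit kappa rho tau (psi tau) n ->
  16 * L <= height * 2 ^+ N ->
  G `<=` \bigcup_(i in I) C i ->
  ((height / 4)%:E <= \esum_(i in I `&` near_orbit tau C n) diam (C i))%E.
Proof.
move=> /andP[e0 e1] he L1 psiK psiL psi01 hA AN0 tauE /andP[n0 nN] high hN GC.
have k0 := kappa0; have h0 := height_gt0.
have AND : 1 <= (A * N)%:R ^+ D :> R by rewrite exprn_ege1// ler1n.
have AND0 : 0 < (A * N)%:R ^+ D :> R by lra.
have tau0 : 0 < tau by rewrite tauE divr_gt0// mulr_gt0.
have tau8 : tau <= 1 / 8.
  have c1 := dio_le1 dio.
  by rewrite tauE ler_pdivrMr ?mulr_gt0//; lra.
pose g t := fiber_orbit kappa rho t (psi t) n.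
set l := (2 * kappa + 4) ^+ n * L.
have l0 : 0 <= l by rewrite /l mulr_ge0 ?exprn_ge0//; lra.
pose J i := [set t | 0 <= t <= tau /\ pinch (t - (i + A * N)%:R * rho) < e * (1 / 2) ^+ (i + A * N)].
pose d' i : \bar R := (l * (2 * e * (1 / 2) ^+ (A * N)) * (1 / 2) ^+ i)%:E.
have hp i : 0 <= (1 / 2 : R) ^+ i by rewrite exprn_ge0//; lra.
have d'0 i : (0 <= d' i)%E.
  rewrite lee_fin; apply: mulr_ge0 => //; apply: mulr_ge0 => //.
  by apply: mulr_ge0 => //; apply: mulr_ge0 => //; exact: ltW.
have hlen := @interval_cover_length R height (I `&` near_orbit tau C n) setT
  (fun i => [set p.2 | p in C i]) (fun i => g @` J i)
  (fun i => diam (C i)) d' (ltW h0) (fun i => diam_ge0 (C i)) d'0.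
have {hlen} : (height%:E <= 2%:E * (\esum_(i in I `&` near_orbit tau C n) diam (C i))
    + 2%:E * (\esum_(i in setT) d' i))%E.
  apply: hlen.
  - move=> i x y _ [p Cp <-] [q Cq <-].
    by apply: le_trans (edist_le_diam Cp Cq); exact: edist_ge_snd.
  - move=> i x y _ [t [/andP[t0 t1] ht] <-] [u [/andP[u0 u1] hu] <-].
    rewrite lee_fin -mulrA; apply: le_trans (fiber_orbit_lipschitz rho kappa0 L1 psi01 psiL n t u) _.
    rewrite -/l ler_wpM2l//.
    have tu2 : `|t - u| <= 1 / 2 by rewrite ler_norml; apply/andP; split; lra.
    apply: le_trans (pinch_ge tu2) _.
    have -> : t - u = (t - (i + A * N)%:R * rho) - (u - (i + A * N)%:R * rho) by ring.
    apply: le_trans (pinchB _ _) _.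
    have -> : 2 * e * (1 / 2) ^+ (A * N) * (1 / 2) ^+ i = 2 * (e * (1 / 2) ^+ (i + A * N)).
      by rewrite exprD; ring.
    by lra.
  - move=> y /andP[y0 yh].
    have [t] : exists2 t, t \in `[0, tau] & g t = y.
      apply: IVT; first exact: ltW.
        apply: continuous_subspaceT.
        exact: (fiber_orbit_continuous kappa0 L1 psi01 psiL).
      have g0 : g 0 = 0 by rewrite /g; case: (n) n0 => // k _; exact: fiber_orbit_pinched.
      have gh : height <= g tau by exact: high.
      by rewrite g0 ge_min y0 le_max (le_trans yh gh) orbT.
    rewrite in_itv/= => ttau gy.
    have [Kt|nK] := pselect (good_set e t).
      left; pose x := circle_of (t + n%:R * rho).
      have Gx : G (x, upper_bounding_graph kappa rho x) by exists x.
      have [i Ii Ci] := GC _ Gx; exists i; last first.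
        exists (x, upper_bounding_graph kappa rho x) => //=.
        rewrite upper_bounding_graphE//.
        have [k ->] := circle_of_reprE (t + n%:R * rho).
        by rewrite upper_limit_int -gy /g psiK// fiber_orbit_upper_limit.
      by split => //; exists (x, upper_bounding_graph kappa rho x) => //; exists t.
    right.
    have /existsNP[m /negP] : ~ (forall i, e * (1 / 2) ^+ i.+1 <= pinch (t - i.+1%:R * rho)) by [].
    rewrite -ltNge => hm.
    have ANm : (A * N <= m.+1)%N.
      rewrite leqNgt; apply/negP => mAN.
      have m0 : 0 < m.+1%:R ^+ D :> R by rewrite exprn_gt0.
      have mD : m.+1%:R ^+ D <= (A * N)%:R ^+ D :> R.
        by rewrite lerXn2r ?nnegrE// ler_nat ltnW.
      have /andP[t0 t1] := ttau.
      have := dio (ltn0Sn m).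
      have : pinch (m.+1%:R * rho) <= pinch t + pinch (t - m.+1%:R * rho).
        by have := pinchB t (t - m.+1%:R * rho); rewrite opprB addrC subrK.
      have := pinch_le t; rewrite ger0_norm// => p1 p2 p3.
      have p4 := he m.
      have : c / m.+1%:R ^+ D < 4 * tau + c / (2 * m.+1%:R ^+ D) by lra.
      have -> : c / (2 * m.+1%:R ^+ D) = c / m.+1%:R ^+ D / 2 by field; rewrite gt_eqF.
      have -> : 4 * tau = c / (A * N)%:R ^+ D / 2 by rewrite tauE; field; rewrite gt_eqF.
      have : c / (A * N)%:R ^+ D <= c / m.+1%:R ^+ D by rewrite ler_pM2l// lef_pV2 ?posrE.
      lra.
    exists (m.+1 - A * N)%N => //; exists t => //; split => //.
    by rewrite subnK.
have Xd : (\esum_(i in setT) d' i <= (4 * l * (1 / 2) ^+ (A * N))%:E)%E.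
  apply: le_trans (esum_geometric_le _ _) _.
  - by have := d'0 0%N; rewrite lee_fin expr0 mulr1.
  - by apply/andP; split; lra.
  have -> : 1 - 1 / 2 = 1 / 2 :> R by lra.
  rewrite lee_fin ler_pdivrMr; last by lra.
  have := hp (A * N)%N; set X := (1 / 2) ^+ _ => X0.
  have : e * (l * X) <= l * X by rewrite ler_piMl// mulr_ge0.
  lra.
have lN : 4 * l * (1 / 2) ^+ (A * N) <= height / 4.
  have b1 : (2 * kappa + 4) ^+ n <= (2 * kappa + 4) ^+ N.
    by apply: ler_weXn2l; [lra | exact: ltnW].
  have b2 : ((2 * kappa + 4) * (1 / 2) ^+ A) ^+ N <= (1 / 2) ^+ N.
    apply: lerXn2r; rewrite ?nnegrE; [rewrite mulr_ge0//; lra | lra |].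
    have t0 : 0 < 2 ^+ A :> R by rewrite exprn_gt0.
    by rewrite [(1 / 2) ^+ A]expr_div_n expr1n mul1r ler_pdivrMr//; lra.
  have b3 : 4 * L * (1 / 2) ^+ N <= height / 4.
    have t0 : 0 < 2 ^+ N :> R by rewrite exprn_gt0.
    by rewrite [(1 / 2) ^+ N]expr_div_n expr1n mul1r ler_pdivrMr//; lra.
  apply: le_trans b3.
  have -> : 4 * l * (1 / 2) ^+ (A * N) = 4 * L * ((2 * kappa + 4) ^+ n * (1 / 2) ^+ (A * N)).
    by rewrite /l; ring.
  rewrite ler_wpM2l//; first by lra.
  apply: le_trans b2; rewrite [leRHS]exprMn -exprM; exact: ler_wpM2r.
have {Xd} Xd : (\esum_(i in setT) d' i <= (height / 4)%:E)%E.
  by apply: le_trans Xd _; rewrite lee_fin.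
have Z0 : (0 <= \esum_(i in I `&` near_orbit tau C n) diam (C i))%E.
  by apply: esum_ge0 => i _; exact: diam_ge0.
move: Z0; set Z := (\esum_(i in I `&` near_orbit tau C n) diam (C i))%E => Z0 H.
have {}H : (height%:E <= 2%:E * Z + (height / 2)%:E)%E.
  apply: le_trans H _; apply: leeD2l.
  have -> : (height / 2)%:E = (2%:E * (height / 4)%:E)%E.
    by rewrite -EFinM; congr EFin; lra.
  by apply: lee_wpmul2l; rewrite ?lee_fin.
case: Z Z0 H => [z| |//] Z0 H; last by rewrite leey.
move: H; rewrite -EFinM -EFinD !lee_fin; lra.
Qed.

(** The arcs [n rho + [0, tau]] with [n < N] are separated by the Diophantine
    condition, so that a small set meets at most one of them. *)
Lemma near_orbit_disjoint tau N (C : nat -> set (circle R * R)) i n n' :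
  (0 < N)%N -> tau <= c / (8 * N%:R ^+ D) ->
  (diam (C i) < (c / (8 * N%:R ^+ D))%:E)%E -> (n < N)%N -> (n' < N)%N ->
  near_orbit tau C n i -> near_orbit tau C n' i -> n = n'.
Proof.
move=> N0 tauN dC nN n'N; wlog nn : n n' nN n'N / (n <= n')%N => [h Ei Ei'|].
  case: (leqP n n') => [|/ltnW] nn; first exact: h.
  by apply/esym; apply: h.
move=> [p Cp [t /andP[t0 t1] pt]] [q Cq [u /andP[u0 u1] qu]].
apply/eqP; rewrite eqn_leq nn /= leqNgt; apply/negP => {}nn.
have dist : circle_dist p.1 q.1 < c / (8 * N%:R ^+ D).
  by apply: edist_lt_fst; apply: le_lt_trans dC; exact: edist_le_diam.
have [k kE] := circle_of_reprE (t + n%:R * rho).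
have [k' kE'] := circle_of_reprE (u + n'%:R * rho).
have ND : 0 < N%:R ^+ D :> R by rewrite exprn_gt0// ltr0n.
have h1 : pinch ((n' - n)%:R * rho) <= 4 * circle_dist p.1 q.1 + 4 * tau.
  have -> : (n' - n)%:R * rho = (t - u) - (circle_repr p.1 - circle_repr q.1 + (k' - k)%:~R).
    by rewrite pt qu kE kE' rmorphB natrB ?(ltnW nn)//; ring.
  apply: le_trans (pinchB _ _) _; rewrite pinch_int addrC; apply: lerD.
    exact: pinch_le_dist_int.
  apply: le_trans (pinch_le _) _; rewrite ler_pM2l// ler_norml; lra.
have h2 : c / N%:R ^+ D <= pinch ((n' - n)%:R * rho).
  have d0 : (0 < n' - n)%N by rewrite subn_gt0.
  apply: le_trans (dio d0); rewrite ler_pM2l// lef_pV2 ?posrE ?exprn_gt0 ?ltr0n//.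
  by rewrite lerXn2r ?nnegrE// ler_nat (leq_trans (leq_subr _ _))// ltnW.
have E : c / N%:R ^+ D = 8 * (c / (8 * N%:R ^+ D)) by field; rewrite gt_eqF.
rewrite E in h2; lra.
Qed.

Lemma esum_disjoint_le (I : set nat) (N : nat) (P : pred nat) (E : nat -> set nat)
    (f : nat -> \bar R) : (forall i, (0 <= f i)%E) ->
  (forall i n n', I i -> (n < N)%N -> (n' < N)%N -> E n i -> E n' i -> n = n') ->
  (\sum_(n < N | P n) \esum_(i in I `&` E n) f i <= \esum_(i in I) f i)%E.
Proof.
move=> f0 disj.
under eq_bigr do rewrite esum_mkcondr.
rewrite -esum_sum; last by move=> i n _ _; case: ifP.
apply: le_esum => i Ii.
have [[n [nN [Pn En]]]|no] := pselect (exists n : nat, (n < N)%N /\ P n /\ E n i).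
  rewrite (bigD1 (Ordinal nN))//= mem_set// big1 ?adde0// => -[m mN] /andP[/= _ mn].
  case: ifP => // /set_mem Em; move: mn; rewrite -val_eqE /=.
  by rewrite (disj i m n Ii mN nN Em En) eqxx.
rewrite big1// => m Pm; case: ifP => // /set_mem Em.
by exfalso; apply: no; exists m; split => //; split.
Qed.

(** About half of the [N] first images of a short curve are high at their end
    point, and each of them contributes [height / 4] to any fine cover. *)
Lemma premeasure_unbounded (B : R) : exists2 e : R, 0 < e &
  (B%:E <= hausdorff_premeasure 1 e G)%E.
Proof.
have k0 := kappa0; have h0 := height_gt0; have /andP[s0 s1] := sg01.
have [e e01 he] := strip_radius_exists; have /andP[e0 e1] := e01.
have [L L1 [psi [psiK psiL psib]]] := good_extension e01 (good_set0 he).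
pose v := e * (sg / 2).
have v0 : 0 < v by rewrite mulr_gt0//; lra.
have psi01 t : 0 <= psi t <= 1.
  by have /andP[p1 p2] := psib t; rewrite p2 (le_trans (ltW v0)).
have [A0 hA0] := @poly_le_expn R (2 * (2 * kappa + 4)) 0.
(* [A] makes the strips beyond [A * N] thinner than the expansion
   [(2 kappa + 4) ^ N] of [N] iterates by a factor [2 ^ - N]. *)
pose A := A0.+1; have hA : 2 * (2 * kappa + 4) <= 2 ^+ A.
  by have := hA0 A (leqnSn _); rewrite expr0 mulr1.
have [N1 hN1] := @poly_le_expn R (16 * L / height) 0.
have [N2 hN2] := @poly_le_expn R (8 * A%:R ^+ D / (c * v)) D.
pose N3 := (Num.truncn `|B * 4 / height|).+1.
pose N := (N1 + N2 + 2 * N3 + 4)%N.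
have N0 : (0 < N)%N by rewrite /N addn4.
have AN0 : (0 < A * N)%N by rewrite muln_gt0.
have ND : 0 < N%:R ^+ D :> R by rewrite exprn_gt0// ltr0n.
have AD : 1 <= A%:R ^+ D :> R by rewrite exprn_ege1// ler1n.
have AND : (A * N)%:R ^+ D = A%:R ^+ D * N%:R ^+ D :> R by rewrite natrM exprMn.
have [tau tauE] : exists tau, tau = c / (8 * (A * N)%:R ^+ D) by eexists.
have tau0 : 0 < tau by rewrite tauE divr_gt0// mulr_gt0// exprn_gt0// ltr0n.
have tauN : tau <= c / (8 * N%:R ^+ D).
  rewrite tauE AND ler_pM2l// lef_pV2 ?posrE ?mulr_gt0//; last by lra.
  by rewrite ler_pM2l// ler_peMl// ltW.
(* Half of the separation required by [near_orbit_disjoint]. *)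
exists (c / (16 * N%:R ^+ D)); first by rewrite divr_gt0// mulr_gt0.
apply: le_ereal_inf_tmp => _ [I [C [GC Ce ->]]].
under eq_esum do rewrite poweRe1 ?diam_ge0//.
pose P n := (0 < n)%N && ~~ low kappa sg (fiber_orbit kappa rho tau (psi tau) n).
have disj i n n' : I i -> (n < N)%N -> (n' < N)%N ->
    near_orbit tau C n i -> near_orbit tau C n' i -> n = n'.
  move=> Ii; apply: near_orbit_disjoint => //; apply: le_lt_trans (Ce i Ii) _.
  by rewrite lte_fin ltr_pM2l// ltf_pV2 ?posrE ?mulr_gt0// ltr_pM2r//; lra.
apply: le_trans (esum_disjoint_le P (fun i => diam_ge0 (C i)) disj).
apply: (@le_trans _ _ (\sum_(n < N | P n) (height / 4)%:E)%E); last first.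
  apply: lee_sum => n /andP[n0 nlow].
  apply: (piece_length e01 he L1 psiK psiL psi01 hA AN0) => //.
  - by rewrite n0 ltn_ord.
  - move: nlow; rewrite /low -leNgt /height => nlow.
    by rewrite ler_pdivrMr// [leRHS]mulrC.
  - rewrite [leRHS]mulrC -ler_pdivrMr//; have := hN1 N; rewrite expr0 mulr1; apply.
    by rewrite /N -!addnA leq_addr.
rewrite sumEFin lee_fin sumr_const.
have c1 := dio_le1 dio.
have ND1 : 1 <= N%:R ^+ D :> R by rewrite exprn_ege1// ler1n.
have tau8 : 8 * tau <= c / N%:R ^+ D.
  have -> : c / N%:R ^+ D = 8 * (c / (8 * N%:R ^+ D)) by field; rewrite gt_eqF.
  by rewrite ler_pM2l.
have tau1 : tau <= 1 / 8.
  have : c / N%:R ^+ D <= 1 by rewrite ler_pdivrMr// mul1r (le_trans c1).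
  lra.
have /andP[pt0 pt1] := psib tau.
have lowN : (2 * low_count kappa rho sg tau (psi tau) 0 N <= N)%N.
  apply: (@high_times _ tau).
  - by rewrite pt1 andbT (lt_le_trans v0).
  - by rewrite tau0 /=; lra.
  - move=> [|n] nN.
      rewrite mul0r addr0 -{1}(gtr0_norm tau0); apply: pinch_ge.
      by rewrite gtr0_norm//; lra.
    have d1 := dio (ltn0Sn n).
    have d2 : c / N%:R ^+ D <= c / n.+1%:R ^+ D.
      rewrite ler_pM2l// lef_pV2 ?posrE ?exprn_gt0 ?ltr0n//.
      by rewrite lerXn2r ?nnegrE// ler_nat ltnW.
    have d3 : 8 * tau <= pinch (n.+1%:R * rho) by exact: le_trans tau8 (le_trans d2 d1).
    have : pinch (n.+1%:R * rho) <= pinch (tau + n.+1%:R * rho) + pinch tau.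
      by have := pinchB (tau + n.+1%:R * rho) tau; rewrite addrAC subrr add0r.
    have := pinch_le tau; rewrite gtr0_norm//.
    move: (pinch tau) (pinch (tau + _)) (pinch (n.+1%:R * rho)) d3 => x y z h1 h2 h3.
    by lra.
  - apply: (@le_trans _ _ (1 / (tau * v))).
      have pt : 0 < psi tau := lt_le_trans v0 pt0.
      by rewrite !mul1r lef_pV2 ?posrE ?mulr_gt0// ler_wpM2l// ltW.
    have -> : 1 / (tau * v) = 8 * A%:R ^+ D / (c * v) * N%:R ^+ D.
      have /gt_eqF AD0 : 0 < A%:R ^+ D :> R by lra.
      by rewrite tauE AND; field; rewrite AD0 !gt_eqF.
    apply: le_trans (hN2 N _) _; first by rewrite /N -!addnA addnCA leq_addr.
    by apply: lerXn2r; rewrite ?nnegrE//; lra.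
have card : (N3 <= #|[pred n : 'I_N | P n]|)%N.
  have : (N <= #|[pred n : 'I_N | P n]| + low_count kappa rho sg tau (psi tau) 0 N + 1)%N.
    rewrite -sum1_card big_mkcond /= /low_count big_mkord.
    have z1 : (\sum_(n < N) (n == 0%N :> nat))%N = 1%N.
      rewrite (bigD1 (Ordinal N0))//= big1 ?addn0// => m.
      by rewrite -val_eqE /= => /negbTE ->.
    rewrite -[X in (_ <= _ + X)%N]z1 -!big_split /= -[leqLHS]card_ord -sum1_card.
    apply: leq_sum => n _; rewrite inE /P.
    by case: (posnP n) => _ /=; case: (low kappa sg _).
  move=> /(half_count lowN); apply.
  by rewrite /N -[(N1 + N2 + _ + _)%N]addnA leq_addl.
have hB : B * 4 / height <= N3%:R.
  by rewrite (le_trans (ler_norm _))// ltW// truncnS_gt.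
rewrite -mulr_natl.
have : N3%:R <= #|[pred n : 'I_N | P n]|%:R :> R by rewrite ler_nat.
move: hB; rewrite ler_pdivrMr// => hB hc.
have := ler_wpM2r (ltW h0) hc.
rewrite -[#|_|]/(#|[pred n : 'I_N | P n]|); lra.
Qed.

Lemma hausdorff_measure1_upper_graph : hausdorff_measure 1 G = +oo%E.
Proof.
apply/eq_infty => B; have [e e0 he] := premeasure_unbounded B.
exact: le_trans he (hausdorff_premeasure_le_measure _ _ e0).
Qed.

End upper_graph_infinite.

Theorem theorem1p1 (R : realType) (c d : R) (c_gt0 : 0 < c) (d_gt1 : 1 < d) :
  exists2 kappa0 : R, 0 < kappa0 &
    forall rho : R, irrational rho -> diophantine c d rho ->
    forall kappa : R, kappa0 <= kappa ->
      hausdorff_dimension (upper_graph_set kappa rho) = 1%E /\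
      hausdorff_measure 1 (upper_graph_set kappa rho) = +oo%E.
Proof.
pose D := (Num.truncn d).+1.
have dD : d <= D%:R by rewrite ltW// truncnS_gt.
pose sg := tame_rate c D.
have sg0 : 0 < sg.
  by rewrite /sg /tame_rate divr_gt0// exprn_gt0// !divr_gt0// exprn_gt0.
exists ((4 / sg ^+ 2) ^+ 4 * (1 + 16 / sg ^+ 2)).
  by rewrite mulr_gt0 ?addr_gt0 ?exprn_gt0 ?divr_gt0 ?exprn_gt0.
move=> rho _ hdio kappa hk.
have dio := diophantine_pinch c_gt0 dD hdio.
have H1 := hausdorff_measure1_upper_graph c_gt0 dio hk.
split=> //; apply/eqP; rewrite eq_le; apply/andP; split.
  rewrite /hausdorff_dimension ge_max lee01 /=.
  apply: ge_ereal_sup => _ [s [s0 hs] <-]; rewrite lee_fin leNgt; apply/negP => s1.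
  by have := upper_graph_measure_gt1 c_gt0 dio hk s1; rewrite hs.
rewrite /hausdorff_dimension le_max; apply/orP; right.
by apply: ereal_sup_ubound; exists 1.
Qed.
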